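(* Let $I=[0,\gamma)$ with $0<\gamma\le\infty$, let $\varphi$ be an Orlicz function, and let $w$ be a weight function on $I$. If $\varphi$ does not satisfy the $\Delta_2$-condition when $\gamma=\infty$ (respectively, does not satisfy the $\Delta_2^\infty$-condition when $\gamma<\infty$), then the set $\Lambda_{\varphi,w}\setminus(\Lambda_{\varphi,w})_a$ is $\mathfrak{c}$-spaceable in $\Lambda_{\varphi,w}$. Furthermore, the set $(\Lambda_{\varphi,w}\setminus(\Lambda_{\varphi,w})_a)\cup\{0\}$ contains an isometric copy of $\ell_\infty$, i.e. a vector subspace of $\Lambda_{\varphi,w}$ that is linearly isometric to $\ell_\infty$.
   Context: The interval $I=[0,\gamma)$ carries Lebesgue measure $m$. $L_0$ is the space of real Lebesgue measurable functions on $I$ modulo a.e. equality. For $f\in L_0$, $d_f(\lambda)=m(\{t\in I:|f(t)|>\lambda\})$ for $\lambda>0$, and $f^*(t)=\inf\{\lambda>0:d_f(\lambda)\le t\}$ for $t\ge 0$ (with $\inf\varnothing=\infty$). An Orlicz function is a convex function $\varphi:[0,\infty)\to[0,\infty)$ with $\varphi(0)=0=\lim_{u\to0}\varphi(u)$ and $\varphi(u)>0$ for $u>0$ (put $\varphi(\infty)=\infty$). It satisfies the $\Delta_2^\infty$-condition if there are $K>2$, $u_0\ge0$ with $\varphi(2u)\le K\varphi(u)$ for all $u\ge u_0$; the $\Delta_2^0$-condition if there are $K>2$, $u_0>0$ with $\varphi(2u)\le K\varphi(u)$ for all $0\le u\le u_0$; the $\Delta_2$-condition if it satisfies both. A weight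 function on $I$ is a positive, decreasing (i.e. nonincreasing) function $w:I\setminus\{0\}\to(0,\infty)$ with $\int_0^t w<\infty$ for every $t\in I$; if $\gamma=\infty$ it is also assumed that $\int_0^\infty w=\infty$. The modular is $\rho_{\varphi,w}(f)=\int_I\varphi(f^*(t))w(t)\,dt$. The Orlicz-Lorentz space is $\Lambda_{\varphi,w}=\{f\in L_0:\rho_{\varphi,w}(kf)<\infty\text{ for some }k>0\}$ with the Luxemburg norm $\|f\|_{\varphi,w}=\inf\{\varepsilon>0:\rho_{\varphi,w}(f/\varepsilon)\le1\}$ (a Banach space). $(\Lambda_{\varphi,w})_a$ is its closed subspace of order-continuous elements (those $f$ with $\|f_n\|_{\varphi,w}\downarrow0$ whenever $|f_n|\le|f|$ and $|f_n|\downarrow0$ a.e.); it is well known that $(\Lambda_{\varphi,w})_a=\{f\in L_0:\rho_{\varphi,w}(kf)<\infty\text{ for every }k>0\}$. $\mathfrak{c}$ is the cardinality of the continuum; $\ell_\infty$ is the space of bounded real sequences with the supremum norm. A subset $A$ of a topological vector space $X$ is $\mathfrak{c}$-spaceable in $X$ if there is a closed $\mathfrak{c}$-dimensional (algebraic dimension) vector subspace $M$ of $X$ with $M\subset A\cup\{0\}$. *)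

(* Defs.v *)
From HB Require Import structures.
From mathcomp Require Import all_boot all_order all_algebra.
From mathcomp Require Import all_classical all_reals all_analysis.

Set Implicit Arguments.
Unset Strict Implicit.
Unset Printing Implicit Defensive.

Import Order.TTheory GRing.Theory Num.Theory.
Import numFieldTopology.Exports numFieldNormedType.Exports.

Local Open Scope classical_set_scope.
Local Open Scope ring_scope.

(* The library has the quotient {mfun_ mu, T >-> R} of the measurable functions
   by a.e. equality, but not its vector space structure. *)
Section ae_quotient_lmodule.
Local Open Scope quotient_scope.
Context d (T : measurableType d) (R : realType).
Variable mu : {measure set T -> \bar R}.

Local Notation mf := {mfun T >-> R}.
Local Notation L := {mfun_ mu, T >-> R}.

Let mf_lmod : lmodType R := {mfun T >-> R}.

Definition aeq_zero : L := \pi_L ((0 : mf_lmod) : mf).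
Definition aeq_opp (f : L) : L := \pi_L ((- (repr f : mf_lmod)) : mf).
Definition aeq_add (f g : L) : L :=
  \pi_L (((repr f : mf_lmod) + (repr g : mf_lmod)) : mf).
Definition aeq_scale (c : R) (f : L) : L :=
  \pi_L ((c *: (repr f : mf_lmod)) : mf).

Let repr_pi (f : mf) : ae_eq_op mu (repr (\pi_L f)) f.
Proof. by apply/eqmodP; rewrite reprK. Qed.

Let pi_opp (f : mf_lmod) : aeq_opp (\pi_L (f : mf)) = \pi_L ((- f) : mf).
Proof.
apply/eqmodP/asboolP; have /asboolP := repr_pi f.
by apply: filterS => t e _; exact: (congr1 -%R (e I)).
Qed.

Let pi_add (f g : mf_lmod) :
  aeq_add (\pi_L (f : mf)) (\pi_L (g : mf)) = \pi_L ((f + g) : mf).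
Proof.
apply/eqmodP/asboolP; have /asboolP := repr_pi f; have /asboolP := repr_pi g.
by apply: filterS2 => t e1 e2 _; exact: (congr2 +%R (e2 I) (e1 I)).
Qed.

Let pi_scale (c : R) (f : mf_lmod) :
  aeq_scale c (\pi_L (f : mf)) = \pi_L ((c *: f) : mf).
Proof.
apply/eqmodP/asboolP; have /asboolP := repr_pi f.
by apply: filterS => t e _; exact: (congr1 ( *%R c) (e I)).
Qed.

Let piP (f : L) : {g : mf_lmod | f = \pi_L (g : mf)}.
Proof. by exists (repr f); rewrite reprK. Qed.

Let addA : associative aeq_add.
Proof.
move=> f g h; have [f' ->] := piP f; have [g' ->] := piP g.
by have [h' ->] := piP h; rewrite !pi_add addrA.
Qed.

Let addC : commutative aeq_add.
Proof.
move=> f g; have [f' ->] := piP f; have [g' ->] := piP g.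
by rewrite !pi_add addrC.
Qed.

Let add0 : left_id aeq_zero aeq_add.
Proof. by move=> f; have [f' ->] := piP f; rewrite pi_add add0r. Qed.

Let addN : left_inverse aeq_zero aeq_opp aeq_add.
Proof. by move=> f; have [f' ->] := piP f; rewrite pi_opp pi_add addNr. Qed.

HB.instance Definition _ := GRing.isZmodule.Build L addA addC add0 addN.

Let scaleA a b (f : L) : aeq_scale a (aeq_scale b f) = aeq_scale (a * b) f.
Proof. by have [f' ->] := piP f; rewrite !pi_scale scalerA. Qed.

Let scale1 : left_id 1 aeq_scale.
Proof. by move=> f; have [f' ->] := piP f; rewrite pi_scale scale1r. Qed.

Let scaleDr : right_distributive aeq_scale +%R.
Proof.
move=> c f g; have [f' ->] := piP f; have [g' ->] := piP g.
by rewrite [LHS](congr1 _ (pi_add _ _)) !pi_scale scalerDr -pi_add.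
Qed.

Let scaleDl (f : L) : {morph aeq_scale^~ f : a b / a + b}.
Proof.
by move=> a b; have [f' ->] := piP f; rewrite !pi_scale scalerDl -pi_add.
Qed.

HB.instance Definition _ :=
  GRing.Zmodule_isLmodule.Build R L scaleA scale1 scaleDr scaleDl.

Lemma aeq_addE (f g : L) : {ae mu, forall t, (f + g : L) t = f t + g t}.
Proof.
have /asboolP := repr_pi ((repr f : mf_lmod) + (repr g : mf_lmod)).
by apply: filterS => t /(_ I).
Qed.

Lemma aeq_scaleE (c : R) (f : L) : {ae mu, forall t, (c *: f : L) t = c * f t}.
Proof.
have /asboolP := repr_pi (c *: (repr f : mf_lmod)).
by apply: filterS => t /(_ I).
Qed.

End ae_quotient_lmodule.

Section linf.
Context (R : realType).

Definition linf_pred : {pred nat -> R} :=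
  mem [set x : nat -> R | has_ubound (range (fun n => `|x n|))].

Fact linf_submod_closed : submod_closed linf_pred.
Proof.
split; first by rewrite inE /=; exists 0 => _ [n _ <-]; rewrite normr0.
move=> a x y; rewrite !inE /= => -[M HM] [N HN].
exists (`|a| * M + N) => _ [n _ <-].
rewrite (le_trans (ler_normD _ _))// lerD//; last by apply: HN; exists n.
by rewrite normrM ler_wpM2l//; apply: HM; exists n.
Qed.

HB.instance Definition _ :=
  GRing.isSubmodClosed.Build R (nat -> R) linf_pred linf_submod_closed.

Record linf := Linf { linf_val :> nat -> R; linf_valP : linf_val \in linf_pred }.

HB.instance Definition _ := [isSub for linf_val].
HB.instance Definition _ := [Choice of linf by <:].
HB.instance Definition _ := [SubChoice_isSubLmodule of linf by <:].

Definition linf_norm (x : linf) : R := sup (range (fun n => `|x n|)).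

End linf.

Section spaceability.
Context (R : realType) (V : lmodType R).
Implicit Types (N : V -> \bar R) (X A M B : set V).

Definition linear_subspace M := submod_closed (mem M).

Definition linearly_independent B := forall (s : seq V) (c : V -> R),
  uniq s -> [set` s] `<=` B -> \sum_(v <- s) c v *: v = 0 ->
  forall v, v \in s -> c v = 0.

Definition linear_span B : set V := [set x | exists (s : seq V) (c : V -> R),
  [set` s] `<=` B /\ x = \sum_(v <- s) c v *: v].

Definition continuum_dimensional M := exists B : set V,
  [/\ linearly_independent B, linear_span B = M & (B #= [set: R])%card].

(* [M] is closed in [X] for the metric [N (g - f)]; [N] may be infinite
   outside [X]. *)
Definition norm_closed_in N X M := forall f, X f ->
  (forall e : R, 0 < e -> exists2 g, M g & (N (g - f)%R < e%:E)%E) -> M f.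

Definition continuum_spaceable N X A := exists M : set V,
  [/\ M `<=` X, linear_subspace M, norm_closed_in N X M,
      continuum_dimensional M & M `<=` A `|` [set 0]].

(* The range of such a [T] is a subspace linearly isometric to l_infty. *)
Definition contains_isometric_linf N A := exists T : {linear linf R -> V},
  (forall x, N (T x) = (linf_norm x)%:E) /\ range T `<=` A.

End spaceability.

Section orlicz_weight.
Context (R : realType).
Implicit Types (phi w : R -> R) (gamma : \bar R).

(* Only the values of [phi] on [0, +oo[ are relevant. *)
Definition orlicz_function phi :=
  [/\ convex_function (E := R^o) `[0, +oo[ phi,
      phi 0 = 0,
      phi u @[u --> 0^'+] --> (0 : R) &
      forall u, 0 < u -> 0 < phi u].

Definition Delta2_infty phi := exists K u0 : R,
  [/\ 2 < K, 0 <= u0 & forall u, u0 <= u -> phi (2 * u) <= K * phi u].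

Definition Delta2_zero phi := exists K u0 : R,
  [/\ 2 < K, 0 < u0 & forall u, 0 <= u <= u0 -> phi (2 * u) <= K * phi u].

Definition Delta2 phi := Delta2_infty phi /\ Delta2_zero phi.

Definition Iset gamma : set R := [set t | (0 <= t%:E < gamma)%E].

(* The value [w 0] is irrelevant. *)
Definition weight_function gamma w :=
  [/\ (forall t, Iset gamma t -> t != 0 -> 0 < w t),
      (forall s t, Iset gamma s -> Iset gamma t -> s != 0 -> s <= t ->
         w t <= w s),
      (forall t, Iset gamma t ->
         (\int[lebesgue_measure]_(s in `]0%R, t]) (w s)%:E < +oo)%E) &
      gamma = +oo%E ->
        (\int[lebesgue_measure]_(s in `]0%R, +oo[) (w s)%:E = +oo)%E].

End orlicz_weight.

(* The reals with the Lebesgue (not just Borel) measurable sets. *)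
Definition lebesgue_display (R : realType) : measure_display :=
  ((wlength (@idfun R))^*%mu).-cara%mdisp.

Definition lebesgueR (R : realType) : measurableType (lebesgue_display R) :=
  caratheodory_type ((wlength (@idfun R))^*)%mu.

Definition lebesgueR_measure (R : realType) :
  {measure set (lebesgueR R) -> \bar R} := @completed_lebesgue_measure R.

Section L0.
Context (R : realType) (gamma : \bar R).

Lemma measurable_Iset : measurable (Iset gamma : set (lebesgueR R)).
Proof.
apply: sub_caratheodory.
suff [i ->] : exists i : interval R, Iset gamma = [set` i].
  exact: (@measurable_itv R).
rewrite /Iset; case: gamma => [r| |].
- by exists `[0, r[; apply/seteqP; split => t; rewrite /= in_itv.
- exists `[0, +oo[; apply/seteqP; split => t; rewrite /= in_itv /= andbT.
    by move=> /andP[].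
  by move=> t0; apply/andP; split; rewrite // ltry.
- exists `]0, 0[; apply/seteqP; split => t; rewrite /= in_itv /=.
    by rewrite ltNge leNye andbF.
  by move=> /andP[t0 /(lt_trans t0)]; rewrite ltxx.
Qed.

(* Lebesgue measure on the interval, viewed as a measure on the line. *)
Definition lebesgue_I : {measure set (lebesgueR R) -> \bar R} :=
  mrestr (lebesgueR_measure R) measurable_Iset.

Definition L0 := {mfun_ lebesgue_I, lebesgueR R >-> R}.

HB.instance Definition _ := GRing.Lmodule.on L0.

Definition L0_fun (f : L0) : R -> R := aqEqMfun_to_fun f.
Coercion L0_fun : L0 >-> Funclass.

Lemma L0_eqP (f g : L0) :
  f = g <-> {ae lebesgue_I, forall t, f t = g t}.
Proof.
split=> [->|fg]; first exact: aeW.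
suff /eqmodP : ae_eq_op lebesgue_I (repr f) (repr g) by rewrite !reprK.
by apply/asboolP; move: fg; apply: (filterS (Filter := ae_filter_ringOfSetsType lebesgue_I)) => t e _.
Qed.

Lemma L0_addE (f g : L0) : {ae lebesgue_I, forall t, (f + g : L0) t = f t + g t}.
Proof. exact: aeq_addE. Qed.

Lemma L0_scaleE (c : R) (f : L0) :
  {ae lebesgue_I, forall t, (c *: f : L0) t = c * f t}.
Proof. exact: aeq_scaleE. Qed.

End L0.

Section orlicz_lorentz.
Context (R : realType) (gamma : \bar R).
Implicit Types (phi w : R -> R) (f g : L0 gamma).
Local Open Scope ereal_scope.

Definition distribution_fun (f : R -> R) (lambda : R) : \bar R :=
  lebesgue_I gamma [set t | (lambda < `|f t|)%R].

(* [ereal_inf set0 = +oo] *)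
Definition rearrangement (f : R -> R) (t : R) : \bar R :=
  ereal_inf [set lambda%:E | lambda in
    [set lambda : R | (0 < lambda)%R /\ distribution_fun f lambda <= t%:E]].

(* The value at [-oo] is never used: rearrangements are nonnegative. *)
Definition phi_ereal phi (x : \bar R) : \bar R :=
  match x with
  | r%:E => (phi r)%:E
  | +oo => +oo
  | -oo => 0
  end.

Definition modular phi w f : \bar R :=
  \int[lebesgue_measure]_(t in Iset gamma)
    (phi_ereal phi (rearrangement f t) * (w t)%:E).

Definition orlicz_lorentz phi w : set (L0 gamma) :=
  [set f | exists2 k : R, (0 < k)%R & modular phi w (k *: f)%R < +oo].

Definition luxemburg_norm phi w f : \bar R :=
  ereal_inf [set e%:E | e in
    [set e : R | (0 < e)%R /\ modular phi w (e^-1 *: f)%R <= 1]].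

Definition order_continuous phi w : set (L0 gamma) :=
  [set f | orlicz_lorentz phi w f /\
    forall F : nat -> L0 gamma,
      (forall n, {ae lebesgue_I gamma, forall t, (`|F n t| <= `|f t|)%R}) ->
      {ae lebesgue_I gamma, forall t,
        nonincreasing_seq (fun n => `|F n t|%R) /\
        `|F n t|%R @[n --> \oo] --> 0%R} ->
      nonincreasing_seq (fun n => luxemburg_norm phi w (F n)) /\
      luxemburg_norm phi w (F n) @[n --> \oo] --> (0 : \bar R)].

End orlicz_lorentz.

(* Main.v *)
Require Import Defs.
From HB Require Import structures.
From mathcomp Require Import all_boot all_order all_algebra.
From mathcomp Require Import all_classical all_reals all_analysis.
From mathcomp Require Import measurable_realfun.
From mathcomp Require Import ring lra.

(** The space contains a copy of the bounded sequences made of step functions.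
    Suppose disjoint intervals [a n, b n) and heights [u n] are such that
    the function equal to [u n] on each [a n, b n) has modular at most 1, whereas
    the n-th step alone already has modular greater than 1 once it is multiplied
    by [1 + 1/(n+1)].  Color the intervals so that each color occurs infinitely
    often, and send a bounded sequence [x] to the function equal to
    [x (color n) * u n] on the n-th interval.  After division by the supremum of
    [x] the modular is at most 1, so the norm is at most that supremum; and each
    colour [j] recurs at indices [n] for which [1 + 1/(n+1)] is arbitrarily close
    to 1, so the norm is at least each [|x j|].  The map is therefore isometric
    ([lux_linf_embed]).  The lower bound only uses blocks of large index, hence
    survives when finitely many blocks are cut off; the norms of these
    truncations do not tend to 0, and no nonzero image is order continuous
    ([linf_embed_not_order_continuous]).

    The blocks come from the failure of a growth condition
    ([blocks_of_not_Delta2_infty], [blocks_of_not_Delta2_zero]): for any ratio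
    [l > 1] and any constant [K] there are heights [u] with
    [phi (l * u) > K * phi u], arbitrarily large or arbitrarily small according
    to the condition that fails.  With [W t] the integral of [w] over (0, t), the
    right end of the n-th block is chosen so that
    [W (b n) = 2^-(n+1) / phi (u n)], and the previous or the next right end
    serves as left end.

    Two estimates on the modular replace its general theory.  If [|g| >= c] on a
    set of measure [a], then the modular of [g] is at least [phi c * W a]
    ([fun_modular_ge]).  If [|g|] is dominated by steps of heights [u n] located
    in [0, b n), its modular is at most the sum of the [phi (u n) * W (b n)]
    ([fun_modular_le]); the decreasing rearrangement never has to be computed.

    The image is closed ([linf_embed_closed]), for a reason that does not involve
    the triangle inequality of the norm: by the first estimate a small norm means
    smallness in measure, so by the Borel-Cantelli lemma suitable images converge almost
    everywhere to the limit, which is then constant on each block, with values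
    read off from the pointwise limit of the sequences.

    Finally any injective linear image of the bounded sequences has algebraic
    dimension continuum ([continuum_dimensional_range]): it contains the
    independent family of the geometric sequences with ratios in (0, 1), which
    extends to a basis, and it has no more elements than there are reals. *)

Set Implicit Arguments.
Unset Strict Implicit.
Unset Printing Implicit Defensive.

Import Order.TTheory GRing.Theory Num.Theory.
Import numFieldTopology.Exports numFieldNormedType.Exports.

Local Open Scope classical_set_scope.
Local Open Scope ring_scope.

(** * Cardinality of real sequences *)

Section continuum.
Context (R : realType).

Lemma injective_card_le T U (f : T -> U) :
  injective f -> ([set: T] #<= [set: U])%card.
Proof.
move=> finj; have /card_eqPle[_ le1] : (range f #= [set: T])%card.
  by apply: inj_card_eq => x y _ _; exact: finj.
exact: (card_le_trans le1 (card_leT _)).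
Qed.

Let digits (b : nat -> bool) n : R := \sum_(k < n) (b k)%:R / 3 ^+ k.

(* The right-hand side decreases in [n]; for [m <= n] already the digits
   dominate. *)
Let digits_ub b m n : digits b m <= digits b n + 3 / 2 / 3 ^+ n.
Proof.
have pos k : 0 < (3 : R) ^- k by rewrite invr_gt0 exprn_gt0.
have [mn|/ltnW nm] := leqP m n.
  rewrite -(subnK mn); elim: (n - m)%N => [|k IH].
    by rewrite add0n lerDl mulr_ge0// ltW.
  rewrite (@le_trans _ _ (digits b (k + m)))//; last first.
    rewrite addSn /digits big_ord_recr/= -addrA lerDl.
    by rewrite addr_ge0// mulr_ge0// ltW.
  elim: k {IH} => [//|k IH]; apply: (le_trans IH).
  by rewrite addSn /digits big_ord_recr/= lerDl mulr_ge0// ltW.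
suff: digits b m + 3 / 2 / 3 ^+ m <= digits b n + 3 / 2 / 3 ^+ n.
  by apply: le_trans; rewrite lerDl mulr_ge0// ltW.
rewrite -(subnK nm); elim: (m - n)%N => [//|k]; apply: le_trans.
rewrite addSn /digits big_ord_recr/= -addrA lerD2l.
have := pos (k + n)%N; rewrite exprS invfM.
by case: (b _) => /=; lra.
Qed.

Let ternary b : R := sup (range (digits b)).

Let digits_le_ternary b n : digits b n <= ternary b.
Proof.
apply: ub_le_sup; last by exists n.
by exists (digits b 0 + 3 / 2 / 3 ^+ 0) => _ [m _ <-]; exact: digits_ub.
Qed.

Let ternary_le b n : ternary b <= digits b n + 3 / 2 / 3 ^+ n.
Proof.
by apply: ge_sup; [exists (digits b 0), 0 | move=> _ [m _ <-]; exact: digits_ub].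
Qed.

(** With base [3] and digits [0] and [1], the digits beyond a given position
    sum to at most half a unit of that position, so that the first position
    where two digit sequences differ decides the order of their values. *)
Let ternary_lt (b b' : nat -> bool) n : (forall k, (k < n)%N -> b k = b' k) ->
  b n -> ~~ b' n -> ternary b' < ternary b.
Proof.
move=> eqb bn /negbTE b'n.
apply: le_lt_trans (ternary_le b' n.+1) _.
apply: lt_le_trans (digits_le_ternary b n.+1).
rewrite /digits !big_ord_recr/= bn b'n mul0r addr0 mul1r.
rewrite (eq_bigr (fun k : 'I_n => (b k)%:R / 3 ^+ k)); last first.
  by move=> k _; rewrite eqb.
rewrite ltrD2l exprS invfM /=.
have : 0 < (3 : R) ^- n by rewrite invr_gt0 exprn_gt0.
lra.
Qed.

Let ternary_inj : injective ternary.
Proof.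
move=> b b' e; apply/funext => n; apply/eqP; apply: contraT => bn.
have exn : exists k, b k != b' k by exists n.
case: (ex_minnP exn) => m bm mmin.
have eqb k : (k < m)%N -> b k = b' k.
  move=> km; apply/eqP; apply: contraT => /mmin.
  by rewrite leqNgt km.
have [btrue|bfalse] := boolP (b m).
  have := ternary_lt eqb btrue; rewrite e ltxx => -> //.
  by move: bm; rewrite btrue; case: (b' m).
have b'true : b' m by move: bm bfalse; case: (b m); case: (b' m).
have := ternary_lt (fun k km => esym (eqb k km)) b'true bfalse.
by rewrite e ltxx.
Qed.

(** A real is determined by the rationals below it, so a sequence of reals is
    determined by countably many bits, and a sequence of bits is the ternary
    expansion of a real. *)
Lemma card_real_seq_le : ([set: nat -> R] #<= [set: R])%card.
Proof.
(* Bit [pickle (k, q)] tells whether the rational [q] lies below [x k]. *)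
pose bits (x : nat -> R) (n : nat) : bool :=
  if unpickle n is Some (k, q) then ratr (q : rat) < x k else false.
have bits_inj : injective bits.
  move=> x y e; apply/funext => k; apply: contrapT => /eqP.
  have lt_absurd u v : bits u = bits v -> ~ u k < v k.
    move=> euv /rat_in_itvoo[q]; rewrite in_itv/= => /andP[uq qv].
    move: (congr1 (fun g => g (pickle (k, q))) euv).
    by rewrite /bits pickleK qv ltNge (ltW uq).
  by rewrite neq_lt => /orP[/(lt_absurd _ _ e)|/(lt_absurd _ _ (esym e))].
exact: (injective_card_le (inj_comp ternary_inj bits_inj)).
Qed.

Lemma card_linf_le : ([set: linf R] #<= [set: R])%card.
Proof.
apply: card_le_trans card_real_seq_le.
exact: (injective_card_le (@val_inj _ _ (linf R))).
Qed.

End continuum.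

(** * Hamel bases of cardinality continuum *)

Section hamel.
Context (R : realType) (V : lmodType R).
Implicit Types (B M : set V) (v : V).

Lemma linear_subspace_sum M (s : seq V) (c : V -> R) :
  linear_subspace M -> [set` s] `<=` M -> M (\sum_(v <- s) c v *: v).
Proof.
move=> [M0 MD]; elim: s => [|v s IH] sM.
  by rewrite big_nil; apply: set_mem.
rewrite big_cons; apply: set_mem; apply: MD; apply: mem_set.
  by apply: sM; rewrite /= mem_head.
by apply: IH => u us; apply: sM; rewrite /= in_cons us orbT.
Qed.

Lemma linear_span_mem B v : B v -> linear_span B v.
Proof.
move=> Bv; exists [:: v], (fun=> 1); rewrite big_seq1 scale1r; split=> //.
by move=> u /=; rewrite inE => /eqP ->.
Qed.

Lemma linearly_independent_adjoin B v :
  linearly_independent B -> ~ linear_span B v ->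
  linearly_independent (v |` B).
Proof.
move=> Bind vB s c us sB sum0.
have [vs|vs] := boolP (v \in s); last first.
  apply: Bind => // u us'; have [uv|//] := sB u us'.
  by move: vs; rewrite -uv us'.
have rB : [set` rem v s] `<=` B.
  move=> u /=; rewrite mem_rem_uniq// inE => /andP[uv /sB[/eqP|//]].
  by rewrite (negbTE uv).
move: sum0; rewrite (perm_big _ (perm_to_rem vs)) big_cons /= => sum0.
have cv0 : c v = 0.
  apply: contrapT => /eqP cv0; apply: vB.
  exists (rem v s), (fun u => - (c v)^-1 * c u); split => //.
  under eq_bigr do rewrite -scalerA.
  rewrite -scaler_sumr; apply: (scalerI cv0).
  rewrite scalerA mulrN divff// scaleN1r; apply/eqP.
  by rewrite -addr_eq0; apply/eqP.
move=> u us'; have [->//|uv] := eqVneq u v.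
apply: (Bind (rem v s)) => //; first exact: rem_uniq.
  by move: sum0; rewrite cv0 scale0r add0r.
by rewrite mem_rem_uniq// inE uv.
Qed.

(** Zorn's lemma: a vector outside the span of a maximal independent set could
    be added to it. *)
Lemma linearly_independent_basis B0 M : linear_subspace M -> B0 `<=` M ->
  linearly_independent B0 ->
  exists B, [/\ B0 `<=` B, linearly_independent B & linear_span B = M].
Proof.
move=> Msub B0M B0ind.
(* Maximality is sought among the sets that remain independent after adding
   [B0], which lets the empty chain be bounded by the empty set. *)
pose P := [set A : set V | A `<=` M /\ linearly_independent (A `|` B0)].
have P0 : P set0 by split; [exact: sub0set|rewrite set0U].
have chain (F : set (set V)) : F `<=` P -> total_on F subset ->
    P (\bigcup_(X in F) X).
  move=> FP Ftot; split; first by move=> v [X /FP[XM _]] /XM.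
  move=> s c us sF; suff [X [_ Xind] sX] : exists2 X, P X & [set` s] `<=` X `|` B0.
    exact: Xind.
  suff [X [FX|->] sX] : exists2 X, F X \/ X = set0 & [set` s] `<=` X `|` B0.
  - by exists X => //; exact: FP.
  - by exists set0.
  (* A finite subset of the union of a chain lies in one of its members. *)
  elim: s {us} sF => [|v s IH] sF; first by exists set0; [right|].
  have [|X FX sX] := IH.
    by move=> u us; apply: sF; rewrite /= in_cons us orbT.
  have [[Y FY Yv]|B0v] := sF v (mem_head _ _); last first.
    exists X => // u /=; rewrite in_cons => /orP[/eqP ->|/sX//]; by right.
  have [XY|YX] : X `<=` Y \/ Y `<=` X.
  - by case: FX => [FX|->]; [exact: Ftot|left; exact: sub0set].
  - exists Y; first by left.
    move=> u /=; rewrite in_cons => /orP[/eqP ->|/sX[/XY|]]; by [left|right].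
  - exists X => // u /=; rewrite in_cons => /orP[/eqP ->|/sX//].
    by left; exact: YX.
have [A [[AM Aind] Amax]] := Zorn_bigcup chain.
exists (A `|` B0); split; [by move=> v; right|by []|].
apply/seteqP; split => [v [s [c [sAB ->]]]|v Mv].
  by apply: linear_subspace_sum => // u /sAB[/AM|/B0M].
apply: contrapT => vspan.
apply: (Amax (v |` A)).
  rewrite properEneq; split; last by move=> u; right.
  apply/eqP => AvA; apply: vspan; apply: linear_span_mem; left.
  by rewrite AvA; left.
split; first by move=> u [->//|/AM].
by rewrite -setUA; exact: linearly_independent_adjoin.
Qed.

(** A basis containing [B0] is caught between [B0] and [M], so the
    Cantor-Bernstein theorem gives its cardinality. *)
Lemma continuum_dimensional_squeeze B0 M : linear_subspace M -> B0 `<=` M ->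
  linearly_independent B0 -> ([set: R] #<= B0)%card ->
  (M #<= [set: R])%card -> continuum_dimensional M.
Proof.
move=> Msub B0M B0ind RB0 MR.
have [B [B0B Bind BM]] := linearly_independent_basis Msub B0M B0ind.
exists B; split=> //; apply/card_eqPle; split; last first.
  exact: card_le_trans RB0 (subset_card_le B0B).
apply: card_le_trans MR; apply: subset_card_le.
by rewrite -BM => v; exact: linear_span_mem.
Qed.

End hamel.

Lemma linear_subspace_range (R : realType) (U V : lmodType R)
  (f : {linear U -> V}) : linear_subspace (range f).
Proof.
split; first by apply/mem_set; exists 0; rewrite ?linear0.
move=> a u v /set_mem[x _ <-] /set_mem[y _ <-]; apply/mem_set.
by exists (a *: x + y); rewrite ?linearP.
Qed.

Section linf_theory.
Context (R : realType).
Implicit Types x y : linf R.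

Lemma linf_normP x n : `|x n| <= linf_norm x.
Proof.
apply: ub_le_sup; last by exists n.
by have := linf_valP x; rewrite inE.
Qed.

Lemma linf_norm_ge0 x : 0 <= linf_norm x.
Proof. exact: le_trans (linf_normP x 0). Qed.

Lemma linf_norm_le x c : (forall n, `|x n| <= c) -> linf_norm x <= c.
Proof.
by move=> xc; apply: ge_sup; [exists `|x 0|, 0 | move=> _ [n _ <-]].
Qed.

Lemma linf_norm0 : linf_norm (0 : linf R) = 0.
Proof.
apply/eqP; rewrite eq_le linf_norm_ge0 andbT.
by apply: linf_norm_le => n; rewrite normr0.
Qed.

Fact bounded_linf_pred (x : nat -> R) c : (forall n, `|x n| <= c) ->
  x \in @linf_pred R.
Proof. by move=> xc; rewrite inE; exists c => _ [n _ <-]. Qed.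

Definition mk_linf (x : nat -> R) c (xc : forall n, `|x n| <= c) : linf R :=
  Linf (bounded_linf_pred xc).

(** Any injection of the reals into (0, 1) would do. *)
Definition ratio (q : R) : R := (1 + expR q)^-1.

Lemma ratio_inj : injective ratio.
Proof. by move=> p q /invr_inj /addrI /expR_inj. Qed.

Lemma geometric_le1 q n : `|ratio q ^+ n| <= 1.
Proof.
have q0 := expR_gt0 q.
rewrite normrX exprn_ile1// ger0_norm ?invr_ge0 ?invf_le1//; lra.
Qed.

Definition geometric_seq q : linf R := mk_linf (geometric_le1 q).

Section image.
Context (V : lmodType R) (T : {linear linf R -> V}) (Tinj : injective T).

Lemma geometric_seq_inj : injective geometric_seq.
Proof.
move=> p q /(congr1 (fun x : linf R => x 1%N)); rewrite /= !expr1.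
exact: ratio_inj.
Qed.

(** A vanishing combination of geometric sequences vanishes when any polynomial
    is evaluated at the ratios; the polynomial with roots at all the ratios
    but one isolates the coefficient of the remaining one. *)
Lemma geometric_independent :
  linearly_independent (range (fun q => T (geometric_seq q))).
Proof.
move=> s c us sB sum0 v0 v0s.
have /choice[r rP] : forall v, exists q, v \in s -> T (geometric_seq q) = v.
  move=> v; have [vs|vs] := boolP (v \in s); last by exists 0.
  by have [q _ qv] := sB v vs; exists q.
have sumn0 n : \sum_(v <- s) c v * ratio (r v) ^+ n = 0.
  have : T (\sum_(v <- s) c v *: geometric_seq (r v)) = T 0.
    rewrite linear_sum linear0 -[RHS]sum0; apply: eq_big_seq => v vs.
    by rewrite linearZ_LR rP.
  move=> /Tinj /(congr1 (fun x : linf R => x n)).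
  suff -> : linf_val (\sum_(v <- s) c v *: geometric_seq (r v)) n =
            \sum_(v <- s) c v * ratio (r v) ^+ n by [].
  elim: (s) => [|v s' IH]; first by rewrite !big_nil.
  by rewrite !big_cons -IH.
have sump0 (p : {poly R}) : \sum_(v <- s) c v * p.[ratio (r v)] = 0.
  under eq_bigr do rewrite horner_coef mulr_sumr.
  rewrite exchange_big/= big1// => i _.
  under eq_bigr do rewrite mulrCA.
  by rewrite -mulr_sumr sumn0 mulr0.
pose zs := [seq ratio (r v) | v <- rem v0 s].
have := sump0 (\prod_(a <- zs) ('X - a%:P)).
rewrite (perm_big _ (perm_to_rem v0s)) big_cons /= [X in _ + X]big1_seq.
  rewrite addr0 => /eqP; rewrite mulf_eq0 => /orP[/eqP//|].
  rewrite -rootE root_prod_XsubC => /mapP[v].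
  rewrite mem_rem_uniq// inE => /andP[vv0 vs] /ratio_inj rv.
  by move: vv0; rewrite -(rP v vs) -(rP v0 v0s) rv eqxx.
move=> v /andP[_ vs]; apply/eqP; rewrite mulf_eq0 -rootE root_prod_XsubC.
by apply/orP; right; apply/mapP; exists v.
Qed.

(** The image of [l_infty] under an injective linear map has as many points as
    there are real sequences, and contains a geometric sequence for each real. *)
Lemma continuum_dimensional_range : continuum_dimensional (range T).
Proof.
apply: (@continuum_dimensional_squeeze _ _
    (range (fun q => T (geometric_seq q)))).
- exact: linear_subspace_range.
- by move=> _ [q _ <-]; exists (geometric_seq q).
- exact: geometric_independent.
- have /card_eqPle[] // :
    (range (fun q => T (geometric_seq q)) #= [set: R])%card.
  apply: inj_card_eq => p q _ _ /Tinj; exact: geometric_seq_inj.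
- exact: card_le_trans (card_image_le _ _) (card_linf_le R).
Qed.

End image.
End linf_theory.

(** * Orlicz functions *)

Section orlicz_theory.
Context (R : realType) (phi : R -> R).
Hypothesis orlicz_phi : orlicz_function phi.

Let phi0 : phi 0 = 0. Proof. by case: orlicz_phi. Qed.

Let phi_gt0 u : 0 < u -> 0 < phi u. Proof. by case: orlicz_phi => _ _ _; apply. Qed.

Lemma orlicz_ge0 u : 0 <= u -> 0 <= phi u.
Proof. by rewrite le_eqVlt => /predU1P[<-|/phi_gt0/ltW//]; rewrite phi0. Qed.

Lemma orlicz_convex t x y : 0 <= t <= 1 -> 0 <= x -> 0 <= y ->
  phi (t * x + (1 - t) * y) <= t * phi x + (1 - t) * phi y.
Proof.
move=> /andP[t0 t1] x0 y0; have [cvx _ _ _] := orlicz_phi.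
have := cvx (@Itv01 _ t t0 t1) x y; rewrite !inE/= !in_itv/= !andbT.
by move=> /(_ x0 y0); rewrite !convRE.
Qed.

Lemma orlicz_shrink t x : 0 <= t <= 1 -> 0 <= x -> phi (t * x) <= t * phi x.
Proof.
move=> t01 x0; have := orlicz_convex t01 x0 (lexx 0).
by rewrite phi0 !mulr0 !addr0.
Qed.

Lemma orlicz_lt x y : 0 <= x -> x < y -> phi x < phi y.
Proof.
move=> x0 xy; have y0 : 0 < y by exact: le_lt_trans xy.
have xy1 : x / y < 1 by rewrite ltr_pdivrMr// mul1r.
have xy0 : 0 <= x / y by rewrite divr_ge0// ltW.
have := @orlicz_shrink (x / y) y; rewrite xy0 (ltW xy1) divfK ?gt_eqF//.
move=> /(_ isT (ltW y0))/le_lt_trans; apply.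
by rewrite gtr_pMl// phi_gt0.
Qed.

Lemma orlicz_le x y : 0 <= x -> x <= y -> phi x <= phi y.
Proof.
by move=> x0; rewrite le_eqVlt => /predU1P[->//|/(orlicz_lt x0)/ltW].
Qed.

Lemma orlicz_grow t x : 1 <= t -> 0 <= x -> t * phi x <= phi (t * x).
Proof.
move=> t1 x0; have t0 : 0 < t by exact: lt_le_trans t1.
have := @orlicz_shrink t^-1 (t * x).
rewrite invr_ge0 (ltW t0) invf_le1// t1 mulKf ?gt_eqF//.
move=> /(_ isT); rewrite mulr_ge0 ?(ltW t0)// => /(_ isT).
by rewrite ler_pdivlMl.
Qed.

Lemma orlicz_unbounded c : exists2 u0, 0 < u0 & forall u, u0 <= u -> c < phi u.
Proof.
have p1 := phi_gt0 ltr01.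
exists (1 + `|c| / phi 1) => [|u].
  by rewrite ltr_wpDr// divr_ge0// ltW.
move=> hu; have u1 : 1 <= u by apply: le_trans hu; rewrite lerDl divr_ge0// ltW.
have := orlicz_grow u1 ler01; rewrite mulr1; apply: lt_le_trans.
rewrite -ltr_pdivrMr//; apply: lt_le_trans hu.
rewrite ltr_pwDl// ler_wpM2r ?invr_ge0 ?(ltW p1)//; exact: ler_norm.
Qed.

(** Convexity makes [phi] left-continuous: just below [S] it is within a small
    multiple of [phi (2 * S)] of the chord bound, so a bound on [phi] over a set
    passes to the supremum. *)
Lemma orlicz_sup (E : set R) c : E !=set0 ->
  (forall u, E u -> 0 <= u /\ phi u <= c) ->
  has_ubound E /\ phi (sup E) <= c.
Proof.
move=> [e0 Ee0] Ec.
have Eub : has_ubound E.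
  have [u0 _ u0P] := orlicz_unbounded c.
  exists u0 => u /Ec[_ uc]; rewrite leNgt; apply/negP => /ltW /u0P.
  by rewrite ltNge uc.
split=> //; set S := sup E.
have S0 : 0 <= S.
  by have [e00 _] := Ec _ Ee0; apply: le_trans e00 _; exact: ub_le_sup.
have c0 : 0 <= c.
  by have [e00 ec] := Ec _ Ee0; exact: le_trans (orlicz_ge0 e00) ec.
move: S0; rewrite le_eqVlt => /predU1P[<-|S0]; first by rewrite phi0.
have p2 : 0 < phi (2 * S) by rewrite phi_gt0// mulr_gt0.
(* A point [u] of [E] above [(1 - d) * S] satisfies
   [S <= (1 - d) * u + d * (2 * S)]. *)
have key d : 0 < d -> d < 1 -> phi S <= c + d * phi (2 * S).
  move=> d0 d1; have [||u Eu du] := @sup_adherent _ E (d * S).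
  - by rewrite mulr_gt0.
  - by split; [exists e0|].
  have [u0 uc] := Ec _ Eu.
  have dS : 0 < d * S by rewrite mulr_gt0.
  have cvx : phi ((1 - d) * u + d * (2 * S)) <=
      (1 - d) * phi u + d * phi (2 * S).
    have d01 : 0 <= 1 - d <= 1 by apply/andP; split; lra.
    have S20 : 0 <= 2 * S by lra.
    by have := orlicz_convex d01 u0 S20; rewrite subKr.
  have le1 : phi S <= phi ((1 - d) * u + d * (2 * S)).
    apply: orlicz_le; first exact: ltW.
    rewrite -/S in du.
    have : (1 - d) * (S - d * S) <= (1 - d) * u by rewrite ler_wpM2l; lra.
    have : 0 <= d * d * S by rewrite !mulr_ge0// ltW.
    nra.
  apply: le_trans le1 (le_trans cvx _); rewrite lerD2r; nra.
rewrite leNgt; apply/negP => cS.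
have [d [d0 d1 dS]] : exists d, [/\ 0 < d, d < 1 & d * phi (2 * S) < phi S - c].
  exists (Num.min (1 / 2) ((phi S - c) / phi (2 * S) / 2)).
  have gap : 0 < (phi S - c) / phi (2 * S) / 2 by rewrite !divr_gt0// subr_gt0.
  split.
  - by rewrite lt_min gap; lra.
  - by rewrite gt_min; apply/orP; left; lra.
  - rewrite -ltr_pdivlMr// gt_min; apply/orP; right.
    by move: gap; set q := _ / phi _; lra.
have := key d d0 d1; lra.
Qed.

Let iter_ratio (l K u : R) m : 0 <= K ->
  (forall i, (i < m)%N -> phi (l * (l ^+ i * u)) <= K * phi (l ^+ i * u)) ->
  phi (l ^+ m * u) <= K ^+ m * phi u.
Proof.
move=> K0; elim: m => [|m IH] h; first by rewrite !expr0 !mul1r.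
rewrite !exprS -!mulrA; apply: le_trans (h m _) _ => //.
by rewrite ler_wpM2l// IH// => i im; apply: h; rewrite ltnS ltnW.
Qed.

(* Archimedes and Bernoulli. *)
Let expr_ge2 (l : R) : 1 < l -> exists m, 2 <= l ^+ m.+1.
Proof.
move=> l1; pose m := Num.truncn (l - 1)^-1; exists m.
have d0 : 0 < l - 1 by lra.
have hm : 1 < (l - 1) * m.+1%:R.
  by rewrite mulrC -ltr_pdivrMr// mul1r truncnS_gt.
have bern k : 1 + (l - 1) * k%:R <= l ^+ k.
  elim: k => [|k IH]; first by rewrite mulr0 addr0 expr0.
  rewrite exprS; have : l * (1 + (l - 1) * k%:R) <= l * l ^+ k.
    by rewrite ler_wpM2l//; lra.
  have : 0 <= (l - 1) * (l - 1) * k%:R by rewrite !mulr_ge0//; lra.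
  rewrite -natr1; nra.
have := bern m.+1; lra.
Qed.

(** The factor [2] in the growth conditions can be replaced by any factor
    greater than [1], since finitely many steps of that factor reach [2]. *)
Lemma not_Delta2_infty_ratio : ~ Delta2_infty phi ->
  forall l K u0 : R, 1 < l -> exists u, [/\ u0 <= u, 0 < u & K * phi u < phi (l * u)].
Proof.
move=> nD l K u0 l1; apply: contrapT => h; apply: nD.
have [m m2] := expr_ge2 l1.
(* The growth condition asks for a constant above [2] and a nonnegative
   threshold. *)
pose K' := Num.max 3 K; pose v0 := Num.max 1 u0.
have K'3 : 3 <= K' by rewrite le_max lexx.
have v01 : 1 <= v0 by rewrite le_max lexx.
exists (K' ^+ m.+1), v0; split; [|lra|].
  by apply: (@lt_le_trans _ _ K'); [lra|rewrite ler_eXnr//; lra].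
move=> u vu; have u1 : 1 <= u by exact: le_trans vu.
apply: (@le_trans _ _ (phi (l ^+ m.+1 * u))).
  apply: orlicz_le; first lra.
  by rewrite ler_wpM2r//; lra.
apply: iter_ratio => [|i _]; first lra.
have lu : u <= l ^+ i * u by rewrite ler_peMl ?exprn_ege1//; lra.
rewrite leNgt; apply/negP => hlt; apply: h; exists (l ^+ i * u); split.
- by apply: le_trans lu; apply: le_trans vu; rewrite le_max lexx orbT.
- lra.
- apply: le_lt_trans hlt; rewrite ler_wpM2r ?le_max ?lexx ?orbT//.
  by apply: orlicz_ge0; lra.
Qed.

Lemma not_Delta2_zero_ratio : ~ Delta2_zero phi ->
  forall l K u0 : R, 1 < l -> 0 < u0 ->
  exists u, [/\ u <= u0, 0 < u & K * phi u < phi (l * u)].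
Proof.
move=> nD l K u0 l1 u00; apply: contrapT => h; apply: nD.
have [m m2] := expr_ge2 l1.
have l0 : 0 < l by lra.
pose K' := Num.max 3 K; have K'3 : 3 <= K' by rewrite le_max lexx.
(* All the intermediate points [l ^+ i * u] must stay below [u0]. *)
exists (K' ^+ m.+1), (u0 / l ^+ m.+1); split.
- by apply: (@lt_le_trans _ _ K'); [lra|rewrite ler_eXnr//; lra].
- by rewrite divr_gt0// exprn_gt0.
move=> u /andP[+ uu0]; rewrite le_eqVlt => /predU1P[<-|u_gt0].
  by rewrite mulr0 phi0 mulr0.
apply: (@le_trans _ _ (phi (l ^+ m.+1 * u))).
  apply: orlicz_le; first lra.
  by rewrite ler_wpM2r//; lra.
apply: iter_ratio => [|i im]; first lra.
have lu : 0 < l ^+ i * u by rewrite mulr_gt0// exprn_gt0.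
rewrite leNgt; apply/negP => hlt; apply: h; exists (l ^+ i * u); split => //.
- rewrite (@le_trans _ _ (l ^+ m.+1 * u))//.
    by rewrite ler_wpM2r ?(ltW u_gt0)// ler_weXn2l ?(ltW l1)// ltnW.
  by rewrite mulrC -ler_pdivlMr ?exprn_gt0.
- apply: le_lt_trans hlt; rewrite ler_wpM2r ?le_max ?lexx ?orbT//.
  by apply: orlicz_ge0; lra.
Qed.

End orlicz_theory.

(** * Weights and their primitives *)

Section weight_theory.
Context (R : realType) (gamma : \bar R) (w : R -> R).
Hypothesis weight_w : weight_function gamma w.
Local Notation mu := (@lebesgue_measure R).
Local Open Scope ereal_scope.

Definition primitive (t : R) : R := fine (\int[mu]_(s in `]0%R, t]) (w s)%:E).

Local Notation W := primitive.

Lemma Iset_le (s t : R) : (0 <= s)%R -> (s <= t)%R -> Iset gamma t -> Iset gamma s.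
Proof.
rewrite /Iset /= => s0 st /andP[t0 tg]; rewrite lee_fin s0/=.
by apply: le_lt_trans tg; rewrite lee_fin.
Qed.

Let Iset_ge0 t : Iset gamma t -> (0 <= t)%R.
Proof. by rewrite /Iset /= lee_fin => /andP[]. Qed.

Let w_gt0 t : Iset gamma t -> (0 < t)%R -> (0 < w t)%R.
Proof. by case: weight_w => w0 _ _ _ It t0; apply: w0; rewrite ?gt_eqF. Qed.

Lemma weight_le (s t : R) : Iset gamma t -> (0 < s)%R -> (s <= t)%R -> (w t <= w s)%R.
Proof.
case: weight_w => _ wle _ _ It s0 st; apply: wle => //; last by rewrite gt_eqF.
exact: (Iset_le (ltW s0) st).
Qed.

Lemma weight_measurable (D : set R) : measurable D ->
  D `<=` [set t | Iset gamma t /\ (0 < t)%R] -> is_interval D ->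
  measurable_fun D w.
Proof.
move=> mD DI Ditv.
apply: (measurability (@RGenCInfty.G R)) => [|/= _ [_] [r] -> <-].
  exact: RGenCInfty.measurableE.
apply: is_interval_measurable => s t /=.
rewrite !in_itv/= !andbT => -[Ds rs] [Dt rt] u sut.
have Du : D u by exact: Ditv Ds Dt _ sut.
move: sut => /andP[su ut]; split => //=.
rewrite in_itv/= andbT; apply: (le_trans rt); apply: weight_le => //.
  by have [] := DI _ Dt.
by have [] := DI _ Du.
Qed.

Let mw (a t : R) b : (0 <= a)%R -> Iset gamma t ->
  measurable_fun [set` Interval (BRight a) (BSide b t)] (EFin \o w).
Proof.
move=> a0 It; apply/measurable_EFinP.
apply: weight_measurable; [exact: measurable_itv| |exact: interval_is_interval].
move=> s /=; rewrite in_itv /= => /andP[as_ /lteifW st].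
have s0 := le_lt_trans a0 as_; split=> //; exact: (Iset_le (ltW s0) st It).
Qed.

Let w_ge0 (a t : R) : (0 <= a)%R -> Iset gamma t ->
  forall s, `]a, t]%classic s -> 0 <= (w s)%:E.
Proof.
move=> a0 It s /=; rewrite in_itv /= => /andP[as_ st].
have s0 := le_lt_trans a0 as_.
by rewrite lee_fin ltW// w_gt0//; exact: (Iset_le (ltW s0) st It).
Qed.

Lemma primitiveE t : Iset gamma t ->
  (W t)%:E = \int[mu]_(s in `]0%R, t]) (w s)%:E.
Proof.
move=> It; rewrite fineK// ge0_fin_numE; last first.
  by apply: integral_ge0; exact: w_ge0.
by case: weight_w => _ _ + _; exact.
Qed.

Lemma primitive0 : W 0 = 0%R.
Proof. by rewrite /primitive set_itvoc0 integral_set0. Qed.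

Let primitiveB (a b : R) : (0 <= a)%R -> (a <= b)%R -> Iset gamma b ->
  (W b - W a)%:E = \int[mu]_(s in `]a, b]) (w s)%:E.
Proof.
move=> a0 ab Ib; have Ia := Iset_le a0 ab Ib.
rewrite EFinB !primitiveE//.
have split_itv : `]0%R, b]%classic = `]0%R, a] `|` `]a, b] :> set R.
  by rewrite -itv_bndbnd_setU ?bnd_simp.
have mU := @mw 0%R b false (lexx _) Ib; have geU := w_ge0 (lexx 0%R) Ib.
rewrite split_itv in mU geU *; rewrite ge0_integral_setU//; last first.
  rewrite disj_set2E; apply/eqP/seteqP; split => // x /=.
  rewrite !in_itv/= => -[/andP[_ xa] /andP[ax _]].
  by move: (lt_le_trans ax xa); rewrite ltxx.
by rewrite -primitiveE// addeAC subee// add0e.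
Qed.

Lemma primitive_le (a b : R) : (0 <= a)%R -> (a <= b)%R -> Iset gamma b ->
  (W a <= W b)%R.
Proof.
move=> a0 ab Ib; rewrite -subr_ge0 -lee_fin primitiveB//.
by apply: integral_ge0; exact: w_ge0.
Qed.

Lemma primitive_ge0 t : Iset gamma t -> (0 <= W t)%R.
Proof. by move=> It; rewrite -primitive0 primitive_le// Iset_ge0. Qed.

Let primitiveB_le (a b : R) : (0 < a)%R -> (a <= b)%R -> Iset gamma b ->
  (W b - W a <= w a * (b - a))%R.
Proof.
move=> a0 ab Ib; have Ia := Iset_le (ltW a0) ab Ib.
rewrite -lee_fin primitiveB ?(ltW a0)//.
apply: (@le_trans _ _ (\int[mu]_(s in `]a, b]) (cst (w a)%:E s))).
  apply: ge0_le_integral => //.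
  - by apply: w_ge0 => //; exact: ltW.
  - by apply: mw => //; exact: ltW.
  - move=> s /=; rewrite in_itv/= => /andP[as_ sb]; rewrite lee_fin.
    apply: weight_le => //; last exact: ltW.
    exact: Iset_le (ltW (lt_trans a0 as_)) sb Ib.
rewrite integral_cst//= lebesgue_measure_itv /= lte_fin.
by case: ltP => _; rewrite ?mule0 ?lee_fin -?EFinB// mulr_ge0 ?subr_ge0// ltW// w_gt0.
Qed.

Lemma primitive_ge t : Iset gamma t -> (0 < t)%R -> (w t * t <= W t)%R.
Proof.
move=> It t0; rewrite -lee_fin primitiveE//.
apply: (@le_trans _ _ (\int[mu]_(s in `]0%R, t]) (cst (w t)%:E s))).
  by rewrite integral_cst//= lebesgue_measure_itv /= lte_fin t0 sube0 EFinM.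
apply: ge0_le_integral => //.
- by move=> s _; rewrite lee_fin ltW// w_gt0.
- exact: mw.
- move=> s /=; rewrite in_itv/= => /andP[s0 st]; rewrite lee_fin.
  exact: weight_le.
Qed.

Lemma primitive_gt0 t : Iset gamma t -> (0 < t)%R -> (0 < W t)%R.
Proof.
by move=> It t0; apply: lt_le_trans (primitive_ge It t0); rewrite mulr_gt0 ?w_gt0.
Qed.

(** As [w] decreases, an interval of given length carries most weight when it
    starts at the origin. *)
Lemma primitive_subadditive (a b : R) : (0 <= a)%R -> (0 <= b)%R ->
  Iset gamma (a + b)%R -> (W (a + b) <= W a + W b)%R.
Proof.
wlog ab : a b / (a <= b)%R.
  move=> wlg a0 b0 Iab; have [ab|/ltW ba] := leP a b; first exact: wlg.
  by rewrite addrC [leRHS]addrC wlg// addrC.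
move=> a0 b0 Iab; move: a0; rewrite le_eqVlt => /predU1P[<-|a0].
  by rewrite add0r primitive0 add0r.
have bpos := lt_le_trans a0 ab.
have leb : (b <= a + b)%R by rewrite lerDr ltW.
have Ib := Iset_le b0 leb Iab; have Ia := Iset_le (ltW a0) ab Ib.
have := primitiveB_le bpos leb Iab.
rewrite addrK lerBlDr => /le_trans; apply; rewrite lerD2r.
apply: le_trans (primitive_ge Ia a0).
by rewrite ler_wpM2r ?(ltW a0)// weight_le.
Qed.

(** The primitive is continuous, so the intermediate value theorem applies. *)
Lemma primitive_surj (t v : R) : Iset gamma t -> (0 <= v <= W t)%R ->
  exists s, [/\ (0 <= s)%R, (s <= t)%R & W s = v].
Proof.
move=> It /andP[v0 vt]; have t0 := Iset_ge0 It.
have mwc x : Iset gamma x -> measurable_fun `[0%R, x] (EFin \o w).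
  by move=> Ix; apply/emeasurable_fun_itv_obnd_cbndP; exact: mw.
have cE x : Iset gamma x -> parameterized_integral mu 0%R x w = W x.
  by move=> Ix; rewrite /parameterized_integral /Rintegral -integral_itv_obnd_cbnd//; exact: mw.
have wint : mu.-integrable `[0%R, t] (EFin \o w).
  apply/integrableP; split; first exact: mwc.
  rewrite -integral_itv_obnd_cbnd; last first.
    by apply: measurableT_comp => //; exact: mw.
  under eq_integral.
    move=> s; rewrite inE => /(w_ge0 (lexx 0%R) It) ws.
    rewrite gee0_abs//; over.
  by rewrite -primitiveE// ltry.
have [|s] := IVT t0 (parameterized_integral_continuous t0 wint) (v := v).
  have I0 := Iset_le (lexx 0%R) t0 It.
  by rewrite !cE// primitive0 ge_min le_max v0 vt orbT.
rewrite in_itv/= => /andP[s0 st] sv; exists s; split => //.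
by rewrite -cE//; exact: (Iset_le s0 st).
Qed.

Lemma primitive_surj_infty (v : R) : gamma = +oo -> (0 <= v)%R ->
  exists2 s, (0 <= s)%R & W s = v.
Proof.
move=> goo v0.
have It t : (0 <= t)%R -> Iset gamma t.
  by rewrite goo /Iset /= lee_fin ltry andbT.
suff [n vn] : exists n, (v <= W n%:R)%R.
  have vn' : (0 <= v <= W n%:R)%R by rewrite v0.
  by have [s [s0 _ sv]] := primitive_surj (It _ (ler0n _ _)) vn'; exists s.
apply: contrapT => nub.
have Wv n : (W n%:R <= v)%R.
  by rewrite leNgt; apply/negP => /ltW vn; apply: nub; exists n.
case: weight_w => _ _ _ /(_ goo) woo.
have : \int[mu]_(s in `]0%R, n%:R]) (w s)%:E @[n --> \oo] -->
       \int[mu]_(s in \bigcup_n `]0%R, n%:R]%classic) (w s)%:E.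
  apply: ge0_nondecreasing_set_cvg_integral => //.
  - move=> m n mn; rewrite subsetEset => s /=; rewrite !in_itv/= => /andP[-> sm].
    by rewrite (le_trans sm)// ler_nat.
  - by move=> n; apply: mw => //; exact: It.
  - by move=> n; apply: w_ge0 => //; exact: It.
have -> : \bigcup_n `]0%R, n%:R]%classic = `]0%R, +oo[%classic :> set R.
  apply/seteqP; split => s /=.
    by move=> [n _] /=; rewrite !in_itv/= andbT => /andP[].
  rewrite in_itv/= andbT => s0; exists (Num.truncn s).+1 => //=.
  by rewrite in_itv/= s0 ltW// truncnS_gt.
rewrite woo => /cvg_lim => /(_ (@ereal_hausdorff _)) loo.
suff : +oo <= v%:E by rewrite leye_eq.
rewrite -loo; apply: lime_le.
  apply: ereal_nondecreasing_is_cvgn => m n mn.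
  rewrite -(primitiveE (It _ (ler0n _ m))) -(primitiveE (It _ (ler0n _ n))).
  rewrite lee_fin; apply: primitive_le => //; first by rewrite ler_nat.
  exact: It.
by apply: nearW => n; rewrite -(primitiveE (It _ (ler0n _ n))) lee_fin.
Qed.

End weight_theory.

(** * Blocks from the failure of a growth condition *)

Section blocks.
Context (R : realType) (gamma : \bar R) (phi w : R -> R).
Hypotheses (gamma_gt0 : (0 < gamma)%E) (orlicz_phi : orlicz_function phi).
Hypothesis weight_w : weight_function gamma w.
Local Notation W := (primitive w).

(** The excess over [1] bounds the loss in the norm of a single block. *)
Definition dilation (n : nat) : R := 1 + n.+1%:R^-1.

Lemma dilation_gt1 n : 1 < dilation n.
Proof. by rewrite /dilation ltrDl invr_gt0. Qed.

Lemma dilation_le2 n : dilation n <= 2.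
Proof. by rewrite [leRHS](_ : _ = 1 + 1)// lerD2l invf_le1// ler1n. Qed.

(** [block_modular_le] charges the height [u n] for the whole of [0, b n), so
    that it remains summable after rearrangement; [block_dilation_gt1] charges
    it only for the length of the block, moved to the origin. *)
Record block_sequence (u a b : nat -> R) : Prop := BlockSequence {
  block_height_gt0 : forall n, 0 < u n;
  block_left_ge0 : forall n, 0 <= a n;
  block_lt : forall n, a n < b n;
  block_Iset : forall n, Iset gamma (b n);
  block_disjoint : forall m n, (m < n)%N -> b m <= a n \/ b n <= a m;
  block_modular_le : forall n, phi (u n) * W (b n) <= 2 ^- n.+1;
  block_dilation_gt1 :
    forall n, 1 < phi (dilation n * u n) * W (b n - a n) }.

Let phi_gt0 u : 0 < u -> 0 < phi u.
Proof. by move=> u0; case: orlicz_phi => _ _ _; apply. Qed.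

Lemma Iset_pos : exists2 t, 0 < t & Iset gamma t.
Proof.
move: gamma_gt0; rewrite /Iset; case: (gamma) => [r| |//].
  rewrite lte_fin => r0; exists (r / 2); first lra.
  by rewrite /= lee_fin lte_fin; apply/andP; split; lra.
by exists 1 => //=; rewrite lee_fin ler01 ltry.
Qed.

(** At the weight prescribed for the right end, subadditivity of the primitive
    turns a left end of at most half that weight into the lower bound. *)
Let build_blocks (u a b : nat -> R) :
  (forall n, 0 < u n) ->
  (forall n, 2 ^+ n.+2 * phi (u n) < phi (dilation n * u n)) ->
  (forall n, 0 <= a n) -> (forall n, 0 <= b n) -> (forall n, Iset gamma (b n)) ->
  (forall n, W (b n) = 2 ^- n.+1 / phi (u n)) ->
  (forall n, W (a n) <= W (b n) / 2) -> (forall n, Iset gamma (a n)) ->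
  (forall m n, (m < n)%N -> b m <= a n \/ b n <= a m) ->
  block_sequence u a b.
Proof.
move=> u0 ratio a0 b0 bI Wb Wa aI dis.
have Wb_gt0 n : 0 < W (b n) by rewrite Wb divr_gt0// phi_gt0.
have ab n : a n < b n.
  rewrite ltNge; apply/negP => ba.
  by have := primitive_le weight_w (b0 n) ba (aI n); have := Wa n; have := Wb_gt0 n; lra.
split=> // n; first by rewrite Wb mulrC divfK// gt_eqF// phi_gt0.
have sub : W (b n) <= W (a n) + W (b n - a n).
  have := @primitive_subadditive _ _ _ weight_w (a n) (b n - a n) (a0 n).
  have -> : a n + (b n - a n) = b n by rewrite addrC subrK.
  by apply => //; rewrite subr_ge0 ltW.
have half : W (b n) / 2 <= W (b n - a n) by have := Wa n; lra.
have p0 := phi_gt0 (u0 n).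
apply: (@lt_le_trans _ _ (phi (dilation n * u n) * (W (b n) / 2))); last first.
  rewrite ler_wpM2l// (orlicz_ge0 orlicz_phi)// mulr_ge0 ?ltW//.
  exact: lt_trans ltr01 (dilation_gt1 n).
apply: (@le_lt_trans _ _ (2 ^+ n.+2 * phi (u n) * (W (b n) / 2))).
  have pn : (2 : R) ^+ n.+1 != 0 by rewrite gt_eqF// exprn_gt0.
  rewrite Wb [2 ^+ n.+2]exprS; have pu := gt_eqF p0.
  have -> : 2 * 2 ^+ n.+1 * phi (u n) * (2 ^- n.+1 / phi (u n) / 2) = 1.
    by field; rewrite pn pu.
  exact: lexx.
by rewrite ltr_pM2r// divr_gt0.
Qed.

(** The heights increase and the blocks, from right to left, fill an interval
    at the origin. *)
Lemma blocks_of_not_Delta2_infty : ~ Delta2_infty phi ->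
  exists u a b, block_sequence u a b.
Proof.
move=> nD; have [t0 t0_gt0 It0] := Iset_pos.
have Wt0 := primitive_gt0 weight_w It0 t0_gt0.
have [U U0 UP] := orlicz_unbounded orlicz_phi (W t0)^-1.
have /choice[f fP] : forall nv : nat * R, exists u, [/\ nv.2 <= u, 0 < u &
    2 ^+ nv.1.+2 * phi u < phi (dilation nv.1 * u)].
  move=> [n v] /=.
  exact: (not_Delta2_infty_ratio orlicz_phi nD _ _ (dilation_gt1 n)).
pose u := fix u n := if n is m.+1 then f (n, u m) else f (0%N, U).
have u_gt0 n : 0 < u n.
  by case: n => [|n]; [have [] := fP (0%N, U)|have [] := fP (n.+1, u n)].
have ratio n : 2 ^+ n.+2 * phi (u n) < phi (dilation n * u n).
  by case: n => [|n]; [have [] := fP (0%N, U)|have [] := fP (n.+1, u n)].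
have u_le n : u n <= u n.+1 by have [] := fP (n.+1, u n).
have Uu n : U <= u n.
  elim: n => [|n IH]; first by have [] := fP (0%N, U).
  exact: le_trans (u_le n).
have /choice[b bP] : forall n, exists s, [/\ 0 <= s, s <= t0 &
    W s = 2 ^- n.+1 / phi (u n)].
  move=> n; apply: (primitive_surj weight_w It0).
  have pn := phi_gt0 (u_gt0 n).
  apply/andP; split; first by rewrite divr_ge0// ltW.
  rewrite ler_pdivrMr//.
  apply: (@le_trans _ _ 1); first by rewrite invf_le1 ?exprn_gt0// exprn_ege1//; lra.
  by rewrite mulrC -ler_pdivrMr// mul1r ltW// UP.
have b0 n : 0 <= b n by have [] := bP n.
have Wb n : W (b n) = 2 ^- n.+1 / phi (u n) by have [] := bP n.
have bI n : Iset gamma (b n).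
  by have [b00 bt _] := bP n; exact: Iset_le b00 bt It0.
have Whalf n : W (b n.+1) <= W (b n) / 2.
  have -> : W (b n) / 2 = 2 ^- n.+2 / phi (u n).
    by rewrite Wb [in RHS]exprS invfM mulrAC (mulrC 2^-1).
  rewrite Wb ler_pM2l//.
  by rewrite lef_pV2 ?posrE ?phi_gt0// (orlicz_le orlicz_phi)// ltW.
have b_le n : b n.+1 <= b n.
  rewrite leNgt; apply/negP => bb.
  have := primitive_le weight_w (b0 n) (ltW bb) (bI n.+1).
  have Wbn : 0 < W (b n) by rewrite Wb divr_gt0 ?phi_gt0.
  by have := Whalf n; lra.
exists u, (fun n => b n.+1), b; apply: build_blocks => // m n mn; right.
rewrite -(subnK mn); elim: (n - m.+1)%N => [//|k IH].
exact: le_trans (b_le _) IH.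
Qed.

(** The heights decrease and the blocks, from left to right, exhaust an
    interval starting at the origin. *)
Lemma blocks_of_not_Delta2_zero : gamma = +oo%E -> ~ Delta2_zero phi ->
  exists u a b, block_sequence u a b.
Proof.
move=> goo nD.
have tI t : 0 <= t -> Iset gamma t.
  by move=> t0; rewrite goo /Iset /= lee_fin t0 ltry.
have /choice[f fP] : forall nv : nat * R, exists u, 0 < nv.2 ->
    [/\ u <= nv.2, 0 < u & 2 ^+ nv.1.+2 * phi u < phi (dilation nv.1 * u)].
  move=> [n v] /=; have [v0|v0] := ltP 0 v; last by exists 0.
  have [u uP] := not_Delta2_zero_ratio orlicz_phi nD (2 ^+ n.+2)
    (dilation_gt1 n) v0.
  by exists u.
(* Dividing by [4] beats the factor [2 ^- n.+1], so that the weights still at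
   least double from one block to the next. *)
pose u := fix u n := if n is m.+1 then f (n, u m / 4) else f (0%N, 1).
have u_gt0 n : 0 < u n.
  elim: n => [|n IH]; first by have [] := fP (0%N, 1) ltr01.
  by have [] := fP (n.+1, u n / 4) (divr_gt0 IH (ltr0Sn R 3)).
have ratio n : 2 ^+ n.+2 * phi (u n) < phi (dilation n * u n).
  case: n => [|n]; first by have [] := fP (0%N, 1) ltr01.
  by have [] := fP (n.+1, u n / 4) (divr_gt0 (u_gt0 n) (ltr0Sn R 3)).
have u_le n : u n.+1 <= 4^-1 * u n.
  by rewrite mulrC; have [] := fP (n.+1, u n / 4) (divr_gt0 (u_gt0 n) (ltr0Sn R 3)).
have phi_le n : phi (u n.+1) <= phi (u n) / 4.
  apply: le_trans (orlicz_le orlicz_phi _ (u_le n)) _; first exact: ltW.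
  rewrite [leRHS]mulrC; apply: (orlicz_shrink orlicz_phi); last exact: ltW.
  by apply/andP; split; lra.
have /choice[b bP] : forall n, exists s, 0 <= s /\ W s = 2 ^- n.+1 / phi (u n).
  move=> n.
  have [|s s0 sv] := primitive_surj_infty weight_w goo (v := 2 ^- n.+1 / phi (u n)).
    by rewrite divr_ge0// ltW// phi_gt0.
  by exists s.
have b0 n : 0 <= b n by have [] := bP n.
have Wb n : W (b n) = 2 ^- n.+1 / phi (u n) by have [] := bP n.
have Wb_gt0 n : 0 < W (b n) by rewrite Wb divr_gt0// phi_gt0.
have Whalf n : W (b n) <= W (b n.+1) / 2.
  have pn := phi_gt0 (u_gt0 n); have pn1 := phi_gt0 (u_gt0 n.+1).
  have e : W (b n.+1) * phi (u n.+1) = W (b n) * phi (u n) / 2.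
    by rewrite !Wb !divfK ?gt_eqF// [2 ^+ n.+2]exprS invfM mulrC.
  have := Wb_gt0 n.+1; have := Wb_gt0 n; have := phi_le n; nra.
have b_le n : b n <= b n.+1.
  rewrite leNgt; apply/negP => bb.
  have := primitive_le weight_w (b0 n.+1) (ltW bb) (tI _ (b0 n)).
  by have := Whalf n; have := Wb_gt0 n; lra.
exists u, (fun n => if n is m.+1 then b m else 0), b.
apply: build_blocks => //; try by case.
- by move=> n; exact: tI.
- by case=> [|n]//; rewrite primitive0 divr_ge0// ltW.
- by case=> [|n]; exact: tI.
- move=> m [//|n]; rewrite ltnS => mn; left; rewrite -(subnK mn).
  elim: (n - m)%N => [//|k IH]; exact: le_trans IH (b_le _).
Qed.

End blocks.

(** * Two estimates on the modular *)

Section modular_theory.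
Context (R : realType) (gamma : \bar R) (phi w : R -> R).
Hypothesis orlicz_phi : orlicz_function phi.
Hypothesis weight_w : weight_function gamma w.
Local Notation W := (primitive w).
Local Notation mu := (@lebesgue_measure R).
Local Open Scope ereal_scope.

Let phi0 : phi 0%R = 0%R. Proof. by case: orlicz_phi. Qed.

Let w_gt0 t : Iset gamma t -> (0 < t)%R -> (0 < w t)%R.
Proof. by case: weight_w => w0 _ _ _ It t0; apply: w0; rewrite ?gt_eqF. Qed.

Lemma phi_ereal_ge0 x : 0 <= x -> 0 <= phi_ereal phi x.
Proof. by case: x => [r| |]//=; rewrite !lee_fin; exact: orlicz_ge0. Qed.

Lemma phi_ereal_le x y : 0 <= x -> x <= y -> phi_ereal phi x <= phi_ereal phi y.
Proof.
case: x => [r| |]; case: y => [s| |]//=; rewrite ?leey// ?lee_fin//.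
exact: orlicz_le.
Qed.

Lemma rearrangement_ge0 g t : 0 <= rearrangement gamma g t.
Proof. by apply: le_ereal_inf_tmp => _ [l [l0 _] <-]; rewrite lee_fin ltW. Qed.

Lemma rearrangement_le g l t : (0 < l)%R ->
  distribution_fun gamma g l <= t%:E -> rearrangement gamma g t <= l%:E.
Proof. by move=> l0 gl; apply: ereal_inf_lbound; exists l. Qed.

Lemma rearrangement_nonincreasing g s t : (s <= t)%R ->
  rearrangement gamma g t <= rearrangement gamma g s.
Proof.
move=> st; apply: ereal_inf_le_tmp => _ [l [l0 gl] <-]; exists l => //; split=> //.
by apply: le_trans gl _; rewrite lee_fin.
Qed.

Lemma measurable_gt_norm (g : lebesgueR R -> R) l :
  measurable_fun setT g -> measurable [set t | (l < `|g t|)%R].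
Proof.
move=> mg; have mn : measurable_fun setT (fun t => `|g t|%R).
  by apply: measurableT_comp => //; exact: normr_measurable.
rewrite (_ : [set t | _] = setT `&` (fun t => `|g t|%R) @^-1` `]l, +oo[%classic).
  exact: mn.
by rewrite setTI; apply/seteqP; split => t /=; rewrite in_itv/= andbT.
Qed.

Lemma measurable_ge_norm (g : lebesgueR R -> R) l :
  measurable_fun setT g -> measurable [set t | (l <= `|g t|)%R].
Proof.
move=> mg; have mn : measurable_fun setT (fun t => `|g t|%R).
  by apply: measurableT_comp => //; exact: normr_measurable.
rewrite (_ : [set t | _] = setT `&` (fun t => `|g t|%R) @^-1` `[l, +oo[%classic).
  exact: mn.
by rewrite setTI; apply/seteqP; split => t /=; rewrite in_itv/= andbT.
Qed.

Lemma distribution_fun_ae (f g : lebesgueR R -> R) l :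
  measurable_fun setT f -> measurable_fun setT g ->
  {ae lebesgue_I gamma, forall t, f t = g t} ->
  distribution_fun gamma f l = distribution_fun gamma g l.
Proof.
move=> mf mg [N [mN N0 fgN]].
suff le_dist f' g' : measurable_fun setT f' -> measurable_fun setT g' ->
    (forall t, ~ N t -> f' t = g' t) ->
    distribution_fun gamma f' l <= distribution_fun gamma g' l.
  have fg t : ~ N t -> f t = g t.
    by move=> Nt; apply: contrapT => ne; apply: Nt; exact: fgN.
  apply/eqP; rewrite eq_le !le_dist// => t Nt; exact/esym/fg.
move=> mf' mg' fg; rewrite /distribution_fun.
apply: (@le_trans _ _ (lebesgue_I gamma ([set t | (l < `|g' t|)%R] `|` N))).
  apply: le_measure; rewrite ?inE.
  - exact: measurable_gt_norm.
  - by apply: measurableU => //; exact: measurable_gt_norm.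
  - move=> t /=; have [Nt|Nt] := pselect (N t); first by right.
    by rewrite (fg _ Nt) => ?; left.
by rewrite measureU0//; exact: measurable_gt_norm.
Qed.

Lemma lebesgue_I_itv a b : (0 <= a)%R -> (a <= b)%R -> Iset gamma b ->
  lebesgue_I gamma `[a, b[%classic = (b - a)%:E.
Proof.
move=> a0 ab Ib; rewrite /lebesgue_I /= /mrestr setIidl; last first.
  move=> t /=; rewrite in_itv/= => /andP[at_ tb].
  by apply: Iset_le Ib; [exact: le_trans at_|exact: ltW].
transitivity (mu `[a, b[%classic); first by [].
rewrite lebesgue_measure_itv/= lte_fin; case: ltP => [|ba]; first by rewrite EFinB.
have -> : a = b by apply/eqP; rewrite eq_le ab.
by rewrite subrr.
Qed.

(** The modular on genuine functions, where representatives of a class can be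
    exchanged. *)
Definition fun_modular (g : R -> R) : \bar R :=
  \int[mu]_(t in Iset gamma) (phi_ereal phi (rearrangement gamma g t) * (w t)%:E).

Lemma fun_modular_ae (f g : lebesgueR R -> R) :
  measurable_fun setT f -> measurable_fun setT g ->
  {ae lebesgue_I gamma, forall t, f t = g t} -> fun_modular f = fun_modular g.
Proof.
move=> mf mg fg; apply: eq_integral => t _; congr (phi_ereal _ _ * _).
rewrite /rearrangement; congr (ereal_inf (_ @` _)).
by apply/seteqP; split => l /= []; rewrite (distribution_fun_ae l mf mg fg).
Qed.

(* The value of [w] at the origin is arbitrary, possibly negative,
   so the origin is removed from the domain. *)
Let Ipos : set R := Iset gamma `\ 0%R.

Let IposP t : Ipos t -> Iset gamma t /\ (0 < t)%R.
Proof.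
move=> [It /= t0]; split => //; rewrite lt_neqAle eq_sym; apply/andP; split.
  exact/eqP.
by move: It; rewrite /Iset /= lee_fin => /andP[].
Qed.

Let Ipos_itv : is_interval Ipos.
Proof.
move=> s t /IposP[_ s0] /IposP[It _] u /andP[su ut].
have u0 := lt_le_trans s0 su; split; first exact: Iset_le (ltW u0) ut It.
by apply/eqP; rewrite gt_eqF.
Qed.

Let measurable_Ipos : measurable (Ipos : set (measurableTypeR R)).
Proof. exact: is_interval_measurable. Qed.

Let integrand g t := phi_ereal phi (rearrangement gamma g t) * (w t)%:E.

Let integrand_ge0 g t : Ipos t -> 0 <= integrand g t.
Proof.
move=> /IposP[It t0]; apply: mule_ge0; last by rewrite lee_fin ltW// w_gt0.
exact/phi_ereal_ge0/rearrangement_ge0.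
Qed.

(* A nonincreasing function has intervals as superlevel sets. *)
Let measurable_integrand g : measurable_fun Ipos (integrand g).
Proof.
apply: (measurability (@ErealGenCInfty.G R)) => [|/= _ [_] [r] -> <-].
  exact: ErealGenCInfty.measurableE.
apply: is_interval_measurable => s t /= [Ds rs] [Dt rt] u sut.
have Du : Ipos u by exact: Ipos_itv Ds Dt _ sut.
move: sut => /andP[su ut]; split => //=.
move: rt; rewrite /= !in_itv/= !andbT => /le_trans; apply.
have [[It t0] [Iu u0]] := (IposP Dt, IposP Du).
apply: lee_pmul.
- exact/phi_ereal_ge0/rearrangement_ge0.
- by rewrite lee_fin ltW// w_gt0.
- by rewrite phi_ereal_le ?rearrangement_ge0// rearrangement_nonincreasing.
- by rewrite lee_fin (weight_le weight_w It).
Qed.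

Let fun_modularE g : fun_modular g = \int[mu]_(t in Ipos) integrand g t.
Proof.
by rewrite /Ipos integral_setD1; [|exact: measurable_Ipos|exact: measurable_integrand].
Qed.

(** If [g] is at least [c] in modulus on a set of measure at least [a], then
    its rearrangement is at least [c] on [0, a). *)
Lemma fun_modular_ge (g : lebesgueR R -> R) a c : measurable_fun setT g ->
  (0 < c)%R -> (0 < a)%R -> Iset gamma a ->
  a%:E <= lebesgue_I gamma [set t | (c <= `|g t|)%R] ->
  (phi c * W a)%:E <= fun_modular g.
Proof.
move=> mg c0 a0 Ia ag; rewrite fun_modularE.
have subI : `]0%R, a[%classic `<=` Ipos.
  move=> t /=; rewrite in_itv/= => /andP[t0 ta].
  split; first exact: Iset_le (ltW t0) (ltW ta) Ia.
  by apply/eqP; rewrite gt_eqF.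
have mw : measurable_fun `]0%R, a[ w.
  apply: (weight_measurable weight_w) => //; last exact: interval_is_interval.
  by move=> t /subI /IposP.
apply: (@le_trans _ _ (\int[mu]_(t in `]0%R, a[) integrand g t)); last first.
  apply: ge0_subset_integral => //; first exact: measurable_integrand.
  exact: integrand_ge0.
have -> : (phi c * W a)%:E = \int[mu]_(t in `]0%R, a[) ((phi c)%:E * (w t)%:E).
  rewrite ge0_integralZl//; last 3 first.
  - exact/measurable_EFinP.
  - by move=> t /subI /IposP[It t0]; rewrite lee_fin ltW// w_gt0.
  - by rewrite lee_fin (orlicz_ge0 orlicz_phi)// ltW.
  rewrite integral_itv_bndo_bndc; last exact/measurable_EFinP.
  by rewrite EFinM (primitiveE weight_w Ia).
apply: ge0_le_integral => //.
- move=> t /subI /IposP[It t0]; rewrite -EFinM lee_fin mulr_ge0//.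
    by rewrite (orlicz_ge0 orlicz_phi)// ltW.
  by rewrite ltW// w_gt0.
- by apply: measurable_funeM; exact/measurable_EFinP.
- exact: measurable_funS (@measurable_integrand g).
move=> t /= tI; have [It t0] := IposP (subI _ tI).
apply: lee_pmul => //.
- by rewrite lee_fin (orlicz_ge0 orlicz_phi)// ltW.
- by rewrite lee_fin ltW// w_gt0.
apply: (@phi_ereal_le c%:E); first by rewrite lee_fin ltW.
apply: le_ereal_inf_tmp => _ [l [l0 gl] <-]; rewrite lee_fin leNgt; apply/negP => lc.
have : a%:E <= t%:E.
  apply: le_trans ag (le_trans _ gl); apply: le_measure; rewrite ?inE.
  - exact: measurable_ge_norm.
  - exact: measurable_gt_norm.
  - by move=> s /=; exact: lt_le_trans.
by rewrite lee_fin leNgt; move: tI; rewrite in_itv/= => /andP[_ ->].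
Qed.

(** The rearrangement at [t] is at most the supremum of the [u n] with [t < b n],
    so [phi] of it is at most the sum of the corresponding values of [phi]; the
    contributions of distinct blocks to the modular just add up. *)
Lemma fun_modular_le (g : lebesgueR R -> R) (u b : nat -> R) (c : \bar R) :
  measurable_fun setT g ->
  (forall n, (0 <= u n)%R) -> (forall n, (0 < b n)%R) ->
  (forall n, Iset gamma (b n)) ->
  (forall s l : R, (0 < l)%R -> (l < `|g s|)%R -> Iset gamma s ->
     exists n, (s < b n)%R /\ (l < u n)%R) ->
  \sum_(n <oo) (phi (u n) * W (b n))%:E <= c -> fun_modular g <= c.
Proof.
move=> mg u0 b0 bI gub sumc; apply: le_trans sumc; rewrite fun_modularE.
pose f n := (fun t => (phi (u n))%:E * (w t)%:E) \_ `]0%R, b n[.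
have subI n : `]0%R, b n[%classic `<=` Ipos.
  move=> t /=; rewrite in_itv/= => /andP[t0 tb].
  split; first exact: Iset_le (ltW t0) (ltW tb) (bI n).
  by apply/eqP; rewrite gt_eqF.
have mw n : measurable_fun `]0%R, b n[ (EFin \o w).
  apply/measurable_EFinP.
  apply: (weight_measurable weight_w) => //; last exact: interval_is_interval.
  by move=> t /subI /IposP.
have f0 n t : 0 <= f n t.
  apply: erestrict_ge0 => {}t /subI /IposP[It t0].
  by rewrite -EFinM lee_fin mulr_ge0 ?(orlicz_ge0 orlicz_phi)// ltW// w_gt0.
have mf n : measurable_fun Ipos (f n).
  apply: (@measurable_funS _ _ _ _ setT) => //.
  by apply/(measurable_restrictT _ _).1 => //; exact: measurable_funeM.
have fint n : \int[mu]_(t in Ipos) f n t = (phi (u n) * W (b n))%:E.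
  rewrite -integral_mkcondr setIidr// ge0_integralZl//; last 3 first.
  - exact: mw.
  - by move=> t /subI /IposP[It t0]; rewrite lee_fin ltW// w_gt0.
  - by rewrite lee_fin (orlicz_ge0 orlicz_phi).
  rewrite integral_itv_bndo_bndc ?EFinM; last exact: mw.
  by rewrite (primitiveE weight_w (bI n)).
rewrite -(eq_eseriesr (fun n _ => fint n)) -integral_nneseries//.
apply: ge0_le_integral => //; first exact: integrand_ge0.
- exact: measurable_integrand.
- exact: (@ge0_emeasurable_sum _ _ _ Ipos f xpredT).
move=> t It0; have [It t0] := IposP It0.
have wt := w_gt0 It t0.
have sum_ge n : (t < b n)%R -> (phi (u n) * w t)%:E <= \sum_(n <oo) f n t.
  move=> tb; have <- : f n t = (phi (u n) * w t)%:E.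
    by rewrite /f patchE mem_set ?EFinM//= in_itv/= t0.
  apply: (@le_trans _ _ (\sum_(0 <= i < n.+1) f i t)).
    by rewrite big_nat_recr//= leeDr// sume_ge0.
  by apply: nneseries_lim_ge => k _ _; exact: f0.
have sum0 : 0 <= \sum_(n <oo) f n t by apply: nneseries_ge0 => k _ _; exact: f0.
case sE : (\sum_(n <oo) f n t) => [s| |]; last 2 first.
- by rewrite leey.
- by move: sum0; rewrite sE.
have s0 : (0 <= s)%R by rewrite -lee_fin -sE.
(* Adding [0] keeps the set nonempty when [t] lies beyond all the [b n]. *)
pose E := 0%R |` [set u n | n in [set n | (t < b n)%R]].
have [||Eub phiS] := @orlicz_sup _ _ orlicz_phi E (s / w t)%R.
- by exists 0%R; left.
- move=> _ [->|[n tb <-]]; first by rewrite phi0 divr_ge0// ltW.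
  by split=> //; rewrite ler_pdivlMr// -lee_fin -sE; exact: sum_ge.
have S0 : (0 <= sup E)%R by apply: ub_le_sup => //; left.
suff rS : rearrangement gamma g t <= (sup E)%:E.
  rewrite /integrand.
  apply: (@le_trans _ _ ((phi (sup E))%:E * (w t)%:E)).
    apply: lee_wpmul2r; first by rewrite lee_fin ltW.
    by apply: (@phi_ereal_le _ (sup E)%:E) => //; exact: rearrangement_ge0.
  by rewrite -EFinM lee_fin -ler_pdivlMr.
apply/lee_addgt0Pr => e e0; rewrite -EFinD; apply: rearrangement_le.
  by rewrite ltr_wpDl.
have <- : lebesgue_I gamma `[0%R, t[%classic = t%:E.
  by rewrite lebesgue_I_itv ?subr0// ltW.
rewrite /distribution_fun /lebesgue_I /= /mrestr.
apply: le_measure; rewrite ?inE.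
- by apply: measurableI; [exact: measurable_gt_norm|exact: measurable_Iset].
- apply: measurableI; last exact: measurable_Iset.
  by apply: sub_caratheodory; exact: measurable_itv.
move=> r [/= Seg Is]; split => //=; rewrite in_itv/=.
have [|n [sb Su]] := gub _ _ _ Seg Is; first by rewrite ltr_wpDl.
have r0 : (0 <= r)%R by move: Is; rewrite /Iset /= lee_fin => /andP[].
rewrite r0 ltNge /=; apply/negP => tr.
have : (u n <= sup E)%R.
  by apply: ub_le_sup => //; right; exists n => //=; exact: le_lt_trans sb.
by move=> /(lt_le_trans Su); rewrite gtrDl ltNge ltW.
Qed.

End modular_theory.

(** * Functions constant on blocks *)

Section block_functions.
Context (R : realType) (a b : nat -> R).
Hypothesis disjoint_ab : forall m n, (m < n)%N -> b m <= a n \/ b n <= a m.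
Implicit Types h k : nat -> R.

Let block_uniq m n t : a m <= t < b m -> a n <= t < b n -> m = n.
Proof.
wlog mn : m n / (m < n)%N.
  move=> wlg hm hn; have [mn|nm|//] := ltngtP m n; first exact: wlg hm hn.
  by apply/esym; exact: wlg hn hm.
move=> /andP[am bm] /andP[an bn]; case: (disjoint_ab mn) => h.
- by have := lt_le_trans bm (le_trans h an); rewrite ltxx.
- by have := lt_le_trans bn (le_trans h am); rewrite ltxx.
Qed.

Definition block_fun h : lebesgueR R -> R := fun t =>
  if pselect (exists n, a n <= t < b n) is left e then h (sval (cid e)) else 0.

(** The case distinction does not depend on the values [h], so that algebraic
    identities between block functions reduce to identities between values. *)
Lemma block_funP t :
  (exists n, a n <= t < b n /\ forall h, block_fun h t = h n) \/
  ((forall n, ~~ (a n <= t < b n)) /\ forall h, block_fun h t = 0).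
Proof.
rewrite /block_fun; case: pselect => [e|ne].
  by left; exists (sval (cid e)); split=> //; exact: svalP (cid e).
by right; split=> // n; apply/negP => nt; apply: ne; exists n.
Qed.

Lemma block_funE h n t : a n <= t < b n -> block_fun h t = h n.
Proof.
move=> nt; case: (block_funP t) => [[m [mt ->]]|[/(_ n)]]; last by rewrite nt.
by rewrite (block_uniq mt nt).
Qed.

Lemma measurable_block_fun h : measurable_fun setT (block_fun h).
Proof.
have mA n : measurable (`[a n, b n[%classic : set (lebesgueR R)).
  by apply: sub_caratheodory; exact: measurable_itv.
move=> _ Y mY; rewrite setTI.
have -> : block_fun h @^-1` Y =
    \bigcup_(n in [set n | Y (h n)]) `[a n, b n[%classic `|`
    (if `[< Y 0 >] then ~` \bigcup_n `[a n, b n[%classic else set0).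
  apply/seteqP; split => t /=.
    case: (block_funP t) => [[n [nt ->]] Yh|[nt -> Y0]].
      by left; exists n => //=; rewrite in_itv.
    right; rewrite asboolT// => -[n _ /=]; rewrite in_itv/=.
    by rewrite (negbTE (nt n)).
  move=> [[n Yh /=]|]; first by rewrite in_itv/= => /(block_funE h) ->.
  case: asboolP => // Y0 nt; case: (block_funP t) => [[n [nt' _]]|[_ -> //]].
  by exfalso; apply: nt; exists n => //=; rewrite in_itv.
apply: measurableU; first exact: bigcup_measurable.
by case: ifP => // _; apply: measurableC; exact: bigcupT_measurable.
Qed.

End block_functions.

Section L0_theory.
Context (R : realType) (gamma : \bar R).
Local Open Scope quotient_scope.

Lemma L0_measurable (F : L0 gamma) : measurable_fun setT (F : lebesgueR R -> R).
Proof. exact: measurable_funPT (repr F). Qed.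

Lemma L0_of (g : lebesgueR R -> R) : measurable_fun setT g ->
  {F : L0 gamma | {ae lebesgue_I gamma, forall t, F t = g t}}.
Proof.
move=> mg; pose G : {mfun lebesgueR R >-> R} :=
  HB.pack g (isMeasurableFun.Build _ _ _ _ g mg).
exists (\pi_(L0 gamma) G).
have /eqmodP/asboolP : repr (\pi_(L0 gamma) G) = G %[mod L0 gamma] by rewrite reprK.
apply: (filterS (Filter := ae_filter_ringOfSetsType (lebesgue_I gamma))).
by move=> t /(_ I).
Qed.

End L0_theory.

(** * The isometric copy of the bounded sequences *)

Section color.
Local Open Scope nat_scope.

(** Every natural number is a color occurring infinitely often. *)
Definition color n := logn 2 n.+1.

Lemma color_unbounded j m : exists2 n, m <= n & color n = j.
Proof.
have pos : 0 < 2 ^ j * (m.*2).+1 by rewrite muln_gt0 expn_gt0.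
exists (2 ^ j * (m.*2).+1).-1.
  rewrite -ltnS prednK//; apply: (@leq_trans (m.*2).+1).
    by rewrite ltnS -addnn leq_addr.
  by rewrite leq_pmull// expn_gt0.
rewrite /color prednK// lognM ?expn_gt0// pfactorK// logn_coprime ?addn0//.
by rewrite coprime2n /= odd_double.
Qed.

End color.

Section block_space.
Context (R : realType) (gamma : \bar R) (phi w : R -> R).
Hypotheses (gamma_gt0 : (0 < gamma)%E) (orlicz_phi : orlicz_function phi).
Hypothesis weight_w : weight_function gamma w.
Context (u a b : nat -> R).
Hypothesis blocks : block_sequence gamma phi w u a b.
Local Notation W := (primitive w).
Local Notation mu_I := (lebesgue_I gamma).
Local Notation step := (block_fun a b).
Local Notation lux := (luxemburg_norm phi w).
Implicit Types (h g : nat -> R) (F : L0 gamma) (x y : linf R).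

Let u_gt0 n : 0 < u n. Proof. exact: (block_height_gt0 blocks). Qed.

Let dis := block_disjoint blocks.

Let d_gt0 n : 0 < @dilation R n.
Proof. exact: lt_trans ltr01 (dilation_gt1 R n). Qed.

Let du_gt0 n : 0 < @dilation R n * u n.
Proof. exact: mulr_gt0. Qed.

(* Forms of monotonicity of almost everywhere statements with the measure
   fixed, for which the filter structure is given by hand. *)
Let ae1 (P Q : R -> Prop) : {ae mu_I, forall t, P t} ->
  (forall t, P t -> Q t) -> {ae mu_I, forall t, Q t}.
Proof.
move=> aP PQ; move: aP.
exact: (filterS (Filter := ae_filter_ringOfSetsType mu_I)).
Qed.

Let ae2 (P1 P2 Q : R -> Prop) :
  {ae mu_I, forall t, P1 t} -> {ae mu_I, forall t, P2 t} ->
  (forall t, P1 t -> P2 t -> Q t) -> {ae mu_I, forall t, Q t}.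
Proof.
move=> aP1 aP2 PQ; move: aP1 aP2.
exact: (@filterS2 _ _ (ae_filter_ringOfSetsType mu_I) P1 P2 Q).
Qed.

Definition block_class h : L0 gamma :=
  projT1 (L0_of gamma (measurable_block_fun dis h)).

Lemma block_classE h : {ae mu_I, forall t, block_class h t = step h t}.
Proof. exact: projT2 (L0_of gamma (measurable_block_fun dis h)). Qed.

Let ae_all (P : nat -> R -> Prop) :
  (forall n, {ae mu_I, forall t, P n t}) -> {ae mu_I, forall t, forall n, P n t}.
Proof. exact: (ae_foralln (mu := mu_I)). Qed.

Lemma L0_eq_block F h : {ae mu_I, forall t, F t = step h t} -> F = block_class h.
Proof.
by move=> Fh; apply/L0_eqP; apply: (ae2 Fh (block_classE h)) => t -> ->.
Qed.

Lemma block_class_lin c h g :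
  block_class (fun n => c * h n + g n) = c *: block_class h + block_class g.
Proof.
apply/esym/L0_eq_block.
apply: (ae2 (L0_addE (c *: block_class h) (block_class g)) _ (fun t e1 e2 => etrans e1 e2)).
apply: (ae2 (L0_scaleE c (block_class h))
  (ae2 (block_classE h) (block_classE g) (fun t e1 e2 => conj e1 e2))).
move=> t -> [-> ->]; case: (block_funP a b t) => [[n [_ e]]|[_ e]]; rewrite !e//.
by rewrite mulr0 addr0.
Qed.

Lemma block_class_scale c h :
  c *: block_class h = block_class (fun n => c * h n).
Proof.
apply: L0_eq_block; apply: (ae2 (L0_scaleE c (block_class h)) (block_classE h)).
move=> t -> ->; case: (block_funP a b t) => [[n [_ e]]|[_ e]]; rewrite !e//.
by rewrite mulr0.
Qed.

Lemma block_class_sub h g :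
  block_class (fun n => h n - g n) = block_class h - block_class g.
Proof.
rewrite -scaleN1r addrC -block_class_lin; congr block_class.
by apply/funext => n; rewrite mulN1r addrC.
Qed.

Lemma modular_block h : modular phi w (block_class h) = fun_modular gamma phi w (step h).
Proof.
apply: (fun_modular_ae phi w (L0_measurable (block_class h)) (measurable_block_fun dis h)).
exact: block_classE.
Qed.

Lemma modular_block_le1 h : (forall n, `|h n| <= u n) ->
  (modular phi w (block_class h) <= 1)%E.
Proof.
move=> hu; rewrite modular_block.
apply: (@fun_modular_le _ _ _ _ orlicz_phi weight_w (step h) u b).
- exact: measurable_block_fun.
- by move=> n; exact: ltW.
- by move=> n; apply: le_lt_trans (block_left_ge0 blocks n) (block_lt blocks n).
- exact: (block_Iset blocks).
- move=> s l l0; case: (block_funP a b s) => [[n [/andP[_ sb] ->]]|[_ ->]].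
    by move=> lh _; exists n; split=> //; exact: lt_le_trans (hu n).
  by rewrite normr0 => /(lt_trans l0); rewrite ltxx.
apply: le_trans (epsilon_trick0 xpredT (@ler01 R)).
apply: lee_nneseries => [n _ _|n _]; rewrite lee_fin.
  rewrite mulr_ge0//; first by rewrite (orlicz_ge0 orlicz_phi)// ltW.
  exact: (primitive_ge0 weight_w (block_Iset blocks n)).
by rewrite mul1r natrX; exact: (block_modular_le blocks).
Qed.

Lemma modular_block_gt1 h n : dilation R n * u n <= `|h n| ->
  (1 < modular phi w (block_class h))%E.
Proof.
move=> hn; rewrite modular_block.
have ab := block_lt blocks n; have a0 := block_left_ge0 blocks n.
have bI := block_Iset blocks n.
have ba : 0 < b n - a n by rewrite subr_gt0.
apply: lt_le_trans (fun_modular_ge orlicz_phi weight_w _ (du_gt0 n) ba _ _).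
- by rewrite lte_fin; exact: (block_dilation_gt1 blocks).
- exact: measurable_block_fun.
- by apply: Iset_le bI; [exact: ltW|rewrite gerBl].
rewrite -(lebesgue_I_itv a0 (ltW ab) bI); apply: le_measure; rewrite ?inE.
- by apply: sub_caratheodory; exact: measurable_itv.
- by apply: measurable_ge_norm; exact: measurable_block_fun.
by move=> t /=; rewrite in_itv/= => /(block_funE dis h) ->.
Qed.

Lemma lux_block_le h e : 0 < e -> (forall n, `|h n| <= e * u n) ->
  (lux (block_class h) <= e%:E)%E.
Proof.
move=> e0 he; apply: ereal_inf_lbound; exists e => //; split=> //.
rewrite block_class_scale; apply: modular_block_le1 => n.
by rewrite normrM gtr0_norm ?invr_gt0// ler_pdivrMl.
Qed.

(** Divided by anything smaller, the n-th block alone has modular above [1]. *)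
Lemma lux_block_ge h n :
  ((`|h n| / (dilation R n * u n))%:E <= lux (block_class h))%E.
Proof.
apply: le_ereal_inf_tmp => _ [e [e0 he] <-]; rewrite lee_fin leNgt.
apply/negP => eh; move: he; rewrite leNgt => /negP; apply.
rewrite block_class_scale; apply: (@modular_block_gt1 _ n).
rewrite normrM gtr0_norm ?invr_gt0// ler_pdivlMl//.
by rewrite -ler_pdivlMr// ltW.
Qed.

(** If [F] exceeds [d] on a set of measure more than [d], hence more than some
    [c <= d] lying in the interval, then dividing [F] by a small [e]
    makes the lower bound [phi (d / e) * W c] exceed [1]. *)
Lemma lux_small_measure (d : R) : 0 < d -> exists2 e, 0 < e &
  forall F, (lux F < e%:E)%E -> (distribution_fun gamma F d <= d%:E)%E.
Proof.
move=> d0; have [t0 t0_gt0 It0] := Iset_pos gamma_gt0.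
pose c := Num.min d t0.
have c0 : 0 < c by rewrite lt_min d0.
have Ic : Iset gamma c by apply: Iset_le It0; [exact: ltW|rewrite ge_min lexx orbT].
have Wc := primitive_gt0 weight_w Ic c0.
have [v0 v00 v0P] := orlicz_unbounded orlicz_phi (W c)^-1.
exists (d / v0) => [|F]; first exact: divr_gt0.
move=> /ereal_inf_lt[_ [e [e0 he] <-]]; rewrite lte_fin => ed.
rewrite leNgt; apply/negP => dF; move: he; rewrite leNgt => /negP; apply.
pose eF : lebesgueR R -> R := fun t => e^-1 * F t.
have mF := L0_measurable F.
have meF : measurable_fun setT eF by exact: measurable_funM.
have -> : modular phi w (e^-1 *: F) = fun_modular gamma phi w eF.
  apply: (fun_modular_ae phi w (L0_measurable (e^-1 *: F)) meF).
  exact: L0_scaleE.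
have de : 0 < d / e by exact: divr_gt0.
apply: lt_le_trans (fun_modular_ge orlicz_phi weight_w meF de c0 Ic _).
  rewrite lte_fin -ltr_pdivrMr// div1r; apply: v0P.
  by rewrite ler_pdivlMr// mulrC -ler_pdivlMr// ltW.
apply: (@le_trans _ _ (distribution_fun gamma F d)).
  by apply: (@le_trans _ _ d%:E); [rewrite lee_fin ge_min lexx|exact: ltW].
apply: le_measure; rewrite ?inE.
- exact: measurable_gt_norm.
- exact: measurable_ge_norm.
move=> t /= dFt; rewrite /eF normrM gtr0_norm ?invr_gt0// mulrC.
by rewrite ler_pM2l ?invr_gt0// ltW.
Qed.

Definition linf_embed x : L0 gamma := block_class (fun n => x (color n) * u n).

Lemma linf_embed_linear : linear linf_embed.
Proof.
move=> c x y; rewrite /linf_embed -block_class_lin; congr block_class.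
by apply/funext => n; rewrite /= mulrDl mulrA.
Qed.

HB.instance Definition _ :=
  GRing.isLinear.Build R (linf R) (L0 gamma) _ linf_embed linf_embed_linear.

(** The value [|x j|] is recovered from the n-th blocks with [color n = j], up to
    a factor [dilation n] that tends to [1] along them. *)
Lemma lux_linf_embed x : lux (linf_embed x) = (linf_norm x)%:E.
Proof.
apply/eqP; rewrite eq_le; apply/andP; split.
  apply/lee_addgt0Pr => e e0; rewrite -EFinD; apply: lux_block_le.
    by rewrite ltr_wpDl// linf_norm_ge0.
  move=> n; rewrite normrM (gtr0_norm (u_gt0 n)) ler_wpM2r ?(ltW (u_gt0 n))//.
  by apply: le_trans (linf_normP x _) _; rewrite lerDl ltW.
apply: le_ereal_inf_tmp => _ [e [e0 he] <-]; rewrite lee_fin.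
have lux_e : (lux (linf_embed x) <= e%:E)%E.
  by apply: ereal_inf_lbound; exists e.
apply: linf_norm_le => j; apply/ler_addgt0Pr => d d0.
have [n en nj] := color_unbounded j (Num.truncn (e / d)).
have := le_trans (lux_block_ge (fun n => x (color n) * u n) n) lux_e.
rewrite lee_fin normrM (gtr0_norm (u_gt0 n)) -mulf_div divff ?gt_eqF// mulr1 nj.
rewrite ler_pdivrMr// => /le_trans; apply.
rewrite /dilation mulrDr mulr1 lerD2l ler_pdivrMr// mulrC -ler_pdivrMr//.
by apply: ltW; apply: lt_le_trans (truncnS_gt _) _; rewrite ler_nat.
Qed.

Lemma linf_embed_inj : injective linf_embed.
Proof.
apply: raddf_inj => x x0.
have := lux_linf_embed x; rewrite x0 -(linear0 linf_embed) lux_linf_embed linf_norm0.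
move=> [nx]; apply/val_inj/funext => n; apply/eqP; rewrite -normr_le0.
by have := linf_normP x n; rewrite -nx.
Qed.

Lemma linf_embed_lorentz x : orlicz_lorentz phi w (linf_embed x).
Proof.
have nx : 0 < linf_norm x + 1 by rewrite ltr_wpDl// linf_norm_ge0.
exists (linf_norm x + 1)^-1; first by rewrite invr_gt0.
rewrite block_class_scale; apply: le_lt_trans (ltry 1).
apply: modular_block_le1 => n.
rewrite normrM gtr0_norm ?invr_gt0// ler_pdivrMl// normrM (gtr0_norm (u_gt0 n)).
rewrite ler_wpM2r ?(ltW (u_gt0 n))//; apply: le_trans (linf_normP x _) _.
by rewrite lerDl.
Qed.

(** Cutting off the first blocks gives a sequence decreasing to [0] below a
    nonzero element, but each color still occurs beyond the cut, where the norm
    stays bounded below. *)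
Lemma linf_embed_not_order_continuous x : x != 0 ->
  ~ order_continuous phi w (linf_embed x).
Proof.
move=> x0 [_ oc].
have [j xj] : exists j, x j != 0.
  apply: contrapT => h; move/eqP: x0; apply; apply/val_inj/funext => n.
  by apply: contrapT => /eqP xn; apply: h; exists n.
pose h m n := if (m <= n)%N then x (color n) * u n else 0.
have [||_ lux0] := oc (fun m => block_class (h m)).
- move=> m; apply: (ae2 (block_classE (h m))
    (block_classE (fun n => x (color n) * u n))) => t -> ->.
  case: (block_funP a b t) => [[n [_ e]]|[_ e]]; rewrite !e// /h.
  by case: ifP => // _; rewrite normr0.
- apply: (ae1 (ae_all (fun m => block_classE (h m)))) => t ht.
  have -> : (fun m => `|block_class (h m) t|) = fun m => `|step (h m) t|.
    by apply/funext => m; rewrite ht.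
  case: (block_funP a b t) => [[n [_ e]]|[_ e]]; last first.
    have -> : (fun m => `|step (h m) t|) = fun=> 0.
      by apply/funext => m; rewrite e normr0.
    by split; [move=> ? ?|exact: cvg_cst].
  have -> : (fun m => `|step (h m) t|) = fun m => `|h m n|.
    by apply/funext => m; rewrite e.
  split.
    move=> m m' mm'; rewrite /h; case: (leqP m' n) => [m'n|_].
      by rewrite (leq_trans mm' m'n).
    by rewrite normr0.
  apply: cvg_near_cst; exists n.+1 => // m /= nm.
  by rewrite /h leqNgt nm normr0.
have low m : ((`|x j| / 2)%:E <= lux (block_class (h m)))%E.
  have [n mn nj] := color_unbounded j m.
  apply: le_trans (lux_block_ge (h m) n); rewrite lee_fin /h mn normrM.
  rewrite (gtr0_norm (u_gt0 n)) -mulf_div divff ?gt_eqF// mulr1 nj.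
  rewrite ler_wpM2l// lef_pV2 ?posrE//.
  exact: dilation_le2.
suff : ((`|x j| / 2)%:E <= 0)%E.
  by rewrite lee_fin leNgt divr_gt0// normr_gt0.
rewrite -(cvg_lim (@ereal_hausdorff R) lux0); apply: lime_ge.
  by apply/cvg_ex; exists 0%E.
exact: nearW.
Qed.

(** Choose images within [eps k] of [f] in measure, with summable [eps]: almost
    everywhere they converge to [f] by the Borel-Cantelli lemma, so [f] is a
    block function.  Its values are bounded because [f] stays at distance less
    than [1] from a single image, and the norm controls the values on blocks. *)
Lemma linf_embed_closed :
  norm_closed_in lux (orlicz_lorentz phi w) (range linf_embed).
Proof.
move=> f _ fcl.
pose eps k : R := 1 / (2 ^ k.+1)%:R.
have eps0 k : 0 < eps k by rewrite divr_gt0// ltr0n expn_gt0.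
have /choice[x xP] : forall k, exists x, (lux (linf_embed x - f)%R < 1)%E /\
    (distribution_fun gamma (linf_embed x - f : L0 gamma)%R (eps k) <= (eps k)%:E)%E.
  move=> k; have [e e0 eP] := lux_small_measure (eps0 k).
  have [|g [x _ <-] xf] := fcl (Num.min e 1); first by rewrite lt_min e0 ltr01.
  exists x; split.
    by apply: lt_le_trans xf _; rewrite lee_fin ge_min lexx orbT.
  by apply: eP; apply: lt_le_trans xf _; rewrite lee_fin ge_min lexx.
pose D k : set (lebesgueR R) := [set t | eps k < `|(linf_embed (x k) - f : L0 gamma) t|].
have mD k : measurable (D k) by apply: measurable_gt_norm; exact: L0_measurable.
have D0 : mu_I (lim_sup_set D) = 0%E.
  apply: lim_sup_set_cvg0 => //.
  apply: (@le_lt_trans _ _ 1%E); last exact: ltry.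
  apply: le_trans (epsilon_trick0 xpredT (@ler01 R)).
  by apply: lee_nneseries => // k _; have [_] := xP k.
have aeD : {ae mu_I, forall t, ~ lim_sup_set D t}.
  exists (lim_sup_set D); split=> //; last by move=> t /= /contrapT.
  by apply: bigcapT_measurable => n; apply: bigcup_measurable => k _; exact: mD.
have aeE : {ae mu_I, forall t, forall k, (linf_embed (x k) - f : L0 gamma) t =
    step (fun n => x k (color n) * u n) t - (f : L0 gamma) t}.
  apply: ae_all => k.
  apply: (ae2 (L0_addE (linf_embed (x k)) (- f)) _ (fun t e1 e2 => etrans e1 e2)).
  apply: (ae2 (block_classE (fun n => x k (color n) * u n)) (L0_scaleE (-1) f)).
  by move=> t -> ; rewrite scaleN1r mulN1r => ->.
(* Convergence at one good point of a block of color [j] suffices for this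
   limit to exist. *)
pose y j : R := limn (fun k => x k j).
pose hy n : R := y (color n) * u n.
have fy : f = block_class hy.
  apply: L0_eq_block; apply: (ae2 aeD aeE) => t Dt Et.
  have cvgf : (fun k => step (fun n => x k (color n) * u n) t) @ \oo --> (f : L0 gamma) t.
    apply/cvgrPdist_le => e e0.
    have [N NP] : exists N, forall k, (N <= k)%N -> ~ D k t.
      apply: contrapT => nN; apply: Dt => N _; apply: contrapT => nD.
      by apply: nN; exists N => k Nk Dk; apply: nD; exists k.
    near=> k.
    have /NP : (N <= k)%N by near: k; exists N.
    rewrite /D /= Et distrC => /negP; rewrite -leNgt => /le_trans; apply.
    apply: (@le_trans _ _ (1 / 2 ^+ k)); last first.
      by apply: ltW; near: k; exact: near_infty_natSinv_expn_lt (PosNum e0).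
    rewrite /eps natrX ler_pM2l// lef_pV2 ?posrE ?exprn_gt0//.
    by rewrite ler_weXn2l ?ler1n.
  case: (block_funP a b t) => [[n [_ e]]|[_ e]]; last first.
    have step0 : (fun k => step (fun n => x k (color n) * u n) t) = fun=> 0.
      by apply/funext => k; rewrite e.
    move: cvgf; rewrite e step0 => /(cvg_lim (@Rhausdorff R)) <-.
    exact: lim_cst.
  rewrite e /hy; have un0 := lt0r_neq0 (u_gt0 n).
  suff -> : y (color n) = (f : L0 gamma) t / u n by rewrite divfK.
  apply: cvg_lim => //.
  have -> : (fun k => x k (color n)) = (fun k => step (fun n => x k (color n) * u n) t / u n).
    by apply/funext => k; rewrite e mulfK.
  by apply: cvgMl.
have ybound : forall j, `|y j| <= linf_norm (x 0%N) + 2.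
  move=> j; have [n _ nj] := color_unbounded j 0.
  (* The difference between [f] and the image of [x 0] is a block function. *)
  have [l1 _] := xP 0%N.
  have fx : block_class (fun n => x 0%N (color n) * u n - hy n) =
      linf_embed (x 0%N) - f.
    by apply: etrans (block_class_sub _ hy) _; rewrite fy.
  have := lux_block_ge (fun n => x 0%N (color n) * u n - hy n) n.
  rewrite fx => /le_lt_trans /(_ l1).
  rewrite lte_fin /hy -mulrBl normrM (gtr0_norm (u_gt0 n)).
  rewrite -mulf_div divff ?gt_eqF// mulr1 ltr_pdivrMr// mul1r nj => yx.
  have := ler_normB (x 0%N j) (x 0%N j - y j); rewrite subKr => /le_trans; apply.
  by rewrite lerD ?linf_normP// (le_trans (ltW yx))// dilation_le2.
by exists (mk_linf ybound).
Unshelve. all: by end_near. Qed.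

End block_space.

(** * Spaceability *)

Theorem theorem4p15 (R : realType) (gamma : \bar R) (phi w : R -> R)
  (gamma_gt0 : (0 < gamma)%E)
  (orlicz_phi : orlicz_function phi)
  (weight_w : weight_function gamma w)
  (nDelta2 : gamma = +oo%E -> ~ Delta2 phi)
  (nDelta2_infty : (gamma < +oo)%E -> ~ Delta2_infty phi) :
  continuum_spaceable (luxemburg_norm phi w) (orlicz_lorentz phi w)
    (orlicz_lorentz phi w `\` @order_continuous R gamma phi w) /\
  contains_isometric_linf (luxemburg_norm phi w)
    ((orlicz_lorentz phi w `\` @order_continuous R gamma phi w)
       `|` [set (0 : L0 gamma)]).
Proof.
have [u [a [b bs]]] : exists u a b, block_sequence gamma phi w u a b.
  have [goo|gfin] : gamma = +oo%E \/ (gamma < +oo)%E.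
    by case: (gamma) => [r| |]; [right; exact: ltry|left|right].
  - have [nDi|Di] := pselect (Delta2_infty phi).
      apply: blocks_of_not_Delta2_zero => // Dz.
      by apply: nDelta2.
    exact: blocks_of_not_Delta2_infty.
  - exact/blocks_of_not_Delta2_infty/nDelta2_infty.
pose T := linf_embed bs : {linear linf R -> L0 gamma}.
have normT x : luxemburg_norm phi w (T x) = (linf_norm x)%:E.
  exact: lux_linf_embed.
have rangeT : range T `<=`
    (orlicz_lorentz phi w `\` @order_continuous R gamma phi w) `|` [set 0].
  move=> _ [x _ <-]; have [->|x0] := eqVneq x 0; first by right; rewrite /= linear0.
  left; split; first exact: linf_embed_lorentz.
  exact: linf_embed_not_order_continuous.
split; last by exists T.
exists (range T); split=> //.
- by move=> _ [x _ <-]; exact: linf_embed_lorentz.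
- exact: linear_subspace_range.
- exact: linf_embed_closed.
- apply: continuum_dimensional_range; exact: linf_embed_inj.
Qed.
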